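(* Let $L>0$ and fix an ergodic $S$-invariant Borel probability measure $\kappa$ on $(\mathbb{D}_L)^{\mathbb{Z}}$. Let $(X,T)$ be any uniquely ergodic model of $((\mathbb{D}_L)^{\mathbb{Z}},\kappa,S)$. Let $\boldsymbol{u}\in(\mathbb{D}_L)^{\mathbb{Z}}$ be such that $\text{Q-gen}(\boldsymbol{u})\subset\mathrm{conv}(\kappa_1,\dots,\kappa_m)$, where $\kappa_1,\dots,\kappa_m$ are $S$-invariant Borel probability measures on $(\mathbb{D}_L)^{\mathbb{Z}}$ such that, for each $j=1,\dots,m$, $((\mathbb{D}_L)^{\mathbb{Z}},\kappa_j,S)$ is measure-theoretically isomorphic to $((\mathbb{D}_L)^{\mathbb{Z}},\kappa,S)$. Assume that $\boldsymbol{v}\in(\mathbb{D}_L)^{\mathbb{Z}}$ and that $\frac1N\sum_{n\le N}\boldsymbol{u}(n)\overline{\boldsymbol{v}(n)}$ does not converge to zero as $N\to\infty$. Then the system $(X,T)$ does not satisfy the strong MOMO property relatively to $\boldsymbol{v}$.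
   Context: $\mathbb{D}_L=\{z\in\mathbb{C}:|z|\le L\}$, and $S$ is the left shift on $(\mathbb{D}_L)^{\mathbb{Z}}$. A topological dynamical system $(X,T)$ is a compact metric space with a continuous map $T\colon X\to X$. A uniquely ergodic model of a measure-preserving system is a topological dynamical system with exactly one invariant Borel probability measure, which with this measure is measure-theoretically isomorphic to the given system. $\text{Q-gen}(\boldsymbol{u})$ is the set of weak-* limit points of $\frac1N\sum_{n<N}\delta_{S^n\boldsymbol{u}}$ as $N\to\infty$ (sums over $0\le n<N$). $\mathrm{conv}$ denotes the convex hull. Strong MOMO property of $(X,T)$ relatively to $\boldsymbol{v}$ (using the values $\boldsymbol{v}(n)$, $n\ge0$): for every increasing sequence of integers $0=b_0<b_1<b_2<\cdots$ with $b_{k+1}-b_k\to\infty$, every sequence $(x_k)$ in $X$ and every $f\in C(X)$, $$\frac1{b_K}\sum_{k<K}\Bigl|\sum_{b_k\le n<b_{k+1}}f(T^{n-b_k}x_k)\boldsymbol{v}(n)\Bigr|\to0\quad (K\to\infty).$$ *)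

(* Defs.v *)
From HB Require Import structures.
From mathcomp Require Import all_boot all_order all_algebra.
From mathcomp Require Import complex.
From mathcomp Require Import all_classical all_reals all_analysis.

Set Implicit Arguments.
Unset Strict Implicit.
Unset Printing Implicit Defensive.

Import Order.TTheory GRing.Theory Num.Theory.
Import numFieldNormedType.Exports.

Local Open Scope classical_set_scope.
Local Open Scope ring_scope.

(* A [measurableType] has a distinguished point, so metric spaces carrying
   Borel measures are taken pointed; the point plays no other role. *)
#[short(type="pmetricType")]
HB.structure Definition PointedMetric (K : numDomainType) :=
  { M of Metric K M & Pointed M }.

Definition borel (T : ptopologicalType) := g_sigma_algebraType (@open T).

Section Sequences.
Context {R : realType} (L : {posnum R}).

(* [R[i]^o] is [R[i]] with its norm topology. *)
Definition disc : Type := set_type [set z : R[i]^o | `|z| <= (L%:num)%:C%C].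

Let disc0 : [set z : R[i]^o | `|z| <= (L%:num)%:C%C] 0.
Proof. by rewrite /= normr0 lecR. Qed.

HB.instance Definition _ := Topological.on disc.
HB.instance Definition _ :=
  isPointed.Build disc (exist _ 0 (mem_set disc0)).

Definition biseq := {ptws int -> disc}.

HB.instance Definition _ := Topological.on biseq.
HB.instance Definition _ := isPointed.Build biseq (fun=> point).

Definition entry (u : biseq) (n : int) : R[i] := set_val (u n).

Definition biseq_shift (u : biseq) : biseq := fun n => u (n + 1).

End Sequences.

Section Systems.
Context {R : realType}.

Section Invariance.
Context d (T : measurableType d) (f : T -> T) (mu : probability T R).

Definition invariant_measure := forall A, measurable A -> mu (f @^-1` A) = mu A.

Definition ergodic := invariant_measure /\
  forall A, measurable A -> f @^-1` A = A -> mu A = 0%E \/ mu A = 1%E.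

End Invariance.

(* A bimeasurable equivariant bijection between invariant_measure sets of full
   measure, carrying [mu] to [nu]; [phi] and [psi] are only relevant on [X0]
   and [Y0]. *)
Definition measure_isomorphic d1 d2 (X : measurableType d1)
    (Y : measurableType d2) (mu : probability X R) (f : X -> X)
    (nu : probability Y R) (g : Y -> Y) :=
  exists (X0 : set X) (Y0 : set Y) (phi : X -> Y) (psi : Y -> X),
    [/\ [/\ measurable X0, mu X0 = 1%E & f @` X0 `<=` X0],
        [/\ measurable Y0, nu Y0 = 1%E & g @` Y0 `<=` Y0],
        [/\ phi @` X0 `<=` Y0, psi @` Y0 `<=` X0,
            {in X0, cancel phi psi} & {in Y0, cancel psi phi}],
        measurable_fun X0 phi /\ measurable_fun Y0 psi &
        (forall B, measurable B -> mu (X0 `&` phi @^-1` B) = nu B) /\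
        {in X0, forall x, phi (f x) = g (phi x)}].

Definition uniquely_ergodic_model (X : pmetricType R) (T : X -> X)
    d (Y : measurableType d) (nu : probability Y R) (g : Y -> Y) :=
  [/\ compact [set: X], continuous T &
      exists mu : probability (borel X) R,
        [/\ invariant_measure (T : borel X -> borel X) mu,
            forall mu' : probability (borel X) R,
              invariant_measure (T : borel X -> borel X) mu' ->
              forall A, measurable A -> mu' A = mu A &
            measure_isomorphic mu (T : borel X -> borel X) nu g]].

Definition weakstar_cvg (T : ptopologicalType)
    (mu : nat -> {measure set (borel T) -> \bar R})
    (nu : {measure set (borel T) -> \bar R}) :=
  forall f : T -> R, continuous f ->
    \int[mu n]_x f x @[n --> \oo] --> \int[nu]_x f x.

Definition empirical (T : ptopologicalType) (f : T -> T) (x : T) (N : nat) :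
    {measure set (borel T) -> \bar R} :=
  mscale (N%:R^-1)%:nng
    (msum (fun n => \d_(iter n f x : borel T) : {measure set _ -> \bar R}) N).

(* The space of probability measures on the compact metrizable space [biseq L]
   is weak-* metrizable, so limit points are limits along subsequences. *)
Definition Qgen (L : {posnum R}) (u : biseq L) :
    set (probability (borel (biseq L)) R) :=
  [set nu | exists2 N : nat -> nat, {homo N : i j / (i < j)%N} &
     weakstar_cvg (fun k => empirical (@biseq_shift R L) u (N k)) nu].

Definition conv_hull d (T : measurableType d) m
    (kappa : 'I_m -> probability T R) : set (probability T R) :=
  [set nu | exists c : 'I_m -> R,
     [/\ forall j, 0 <= c j, \sum_j c j = 1 &
         forall A, measurable A -> nu A = (\sum_j (c j)%:E * kappa j A)%E]].

Definition strong_MOMO (X : topologicalType) (T : X -> X)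
    (L : {posnum R}) (v : biseq L) :=
  forall (b : nat -> nat) (x : nat -> X) (f : X -> R[i]^o),
    b 0%N = 0%N -> {homo b : k l / (k < l)%N} ->
    (b k.+1 - b k)%N @[k --> \oo] --> \oo ->
    continuous f ->
    ((b K)%:R^-1 * \sum_(k < K)
       `|\sum_(b k <= n < b k.+1) f (iter (n - b k) T (x k)) * entry v n%:Z|
       : R[i]^o) @[K --> \oo] --> (0 : R[i]^o).

End Systems.

(* Main.v *)
From HB Require Import structures.
Require Import Defs.
From mathcomp Require Import all_boot all_order all_algebra.
From mathcomp Require Import complex.
From mathcomp Require Import all_classical all_reals all_analysis.
From mathcomp Require Import measurable_realfun ring lra zify.
Set Implicit Arguments.
Unset Strict Implicit.
Unset Printing Implicit Defensive.
Import Order.TTheory GRing.Theory Num.Theory.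
Import numFieldNormedType.Exports.
Local Open Scope classical_set_scope.
Local Open Scope ring_scope.

(* Suppose that (X, T) has the strong MOMO property relatively to v.
   Transporting the zeroth coordinate along the isomorphism of each kappa_j with
   the model and approximating it in L^1 by a continuous function f_j on X, the
   window (w(0), .., w(H)) of a kappa_j-typical w is, on average, close to an
   orbit segment (f_j(y), .., f_j(T^H y)).  The distance G(w) of a window to the
   set of all such segments (over all j and y) is a continuous function of w,
   with small integral for every kappa_j, hence for every element of Q-gen(u);
   by weak-* compactness its averages along u are eventually small.  So most
   windows of u follow orbits of the model, and the correlation of u with v is
   controlled by sums of f_j(T^h y_n) conj(v(n + h)) over windows of bounded
   length with arbitrary starting points y_n.  The MOMO property makes these
   negligible: otherwise, for every window length one of the residue classes
   modulo this length carries large sums, and concatenating longer and longer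
   stretches of these progressions gives blocks that violate it. *)

(** * From the strong MOMO property to averages over windows *)

(** The isomorphisms are only measurable, whereas weak-* limits test only continuous functions; the
    point of the model attached to a window therefore cannot be carried along u. Taking the distance
    to all orbit segments at once removes this point: the infimum is continuous, and it lies below
    the deviation from the orbit of the attached point wherever that point is defined. It runs over
    all j as well, since a limit point may mix the kappa_j and no single j need fit u. The order of
    choices matters: the f_j first, with an error that does not depend on the window length, and
    only then the length, which the MOMO property supplies for these functions. MOMO demands block
    lengths that tend to infinity, whereas the windows have one fixed length. A failure at a single
    length yields no admissible blocks; a failure at every length provides stages of lengths 1, 2,
    3, ..., each carried on long enough to dominate the average at its end. Weak-* compactness is
    obtained through a coding by binary sequences, where a measure is a consistent assignment of
    masses to finite words and limits can be taken word by word. *)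

Lemma sum_progressions (R : realType) (H Q : nat) (f : nat -> R) :
  \sum_(n < Q * H) f n = \sum_(r < H) \sum_(i < Q) f (r + i * H)%N.
Proof.
rewrite exchange_big /=; elim: Q => [|Q IH].
  by rewrite !big_ord0.
rewrite big_ord_recr /= -IH mulSn addnC big_split_ord /=; congr (_ + _).
by apply: eq_bigr => i _; rewrite addnC.
Qed.

Section Blocks.
Context {R : realType} {X : Type}.
Variables (g : nat -> nat -> X -> R) (C : R).
Hypotheses (g0 : forall n l x, 0 <= g n l x) (gC : forall n l x, g n l x <= C * l%:R).
Hypothesis g_blocks : forall (b : nat -> nat) (x : nat -> X),
  b 0%N = 0%N -> {homo b : k l / (k < l)%N} ->
  (b k.+1 - b k)%N @[k --> \oo] --> \oo ->
  (b K)%:R^-1 * \sum_(k < K) g (b k) (b k.+1 - b k)%N (x k) @[K --> \oo] --> 0.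

Section Refutation.
Variable d : R.
Hypotheses (d0 : 0 < d).

(* With y = (Q, r, x), the blocks of length s + 1 that start at the terms
   r + i (s + 1), M < i < Q, and use the points x, carry large sums even when
   compared with the end r + Q (s + 1) of the last one.  The terms with i <= M
   are given up so that a stage starting at M can join the progression. *)
Definition rich_progression (s M : nat) (y : nat * nat * (nat -> X)) :=
  [/\ (M + 2 < y.1.1)%N, (y.1.2 <= s)%N &
      d / 2 * (y.1.2 + y.1.1 * s.+1)%:R <=
      \sum_(M.+1 <= i < y.1.1)
         g (y.1.2 + i * s.+1) s.+1 (y.2 (y.1.2 + i * s.+1)%N)].

(** Pigeonhole: the starting points n < N split into s + 1 residue classes, and one of them carries
    at least its share. Half of d is given up to pay for the M + 1 discarded terms and for rounding
    N to a multiple of s + 1. *)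
Lemma exists_rich_progression s M :
  (forall N0, exists N, exists x : nat -> X, (N0 <= N)%N /\
    d * N%:R * s.+1%:R < \sum_(n < N) g n s.+1 (x n)) ->
  exists y, rich_progression s M y.
Proof.
move=> hN.
(* The quotient makes d/2 * Q at least 3d/2 + C (M + 1), that is, d (Q - 1) at least d/2 (Q + 1) + C
   (M + 1). The summand M + 3 ensures M + 2 < Q. *)
pose Q0 := (M + 3 + Num.truncn ((3 * d / 2 + C * M.+1%:R) / (d / 2))).+1%N.
have [N [x [Q0N hx]]] := hN (Q0 * s.+1)%N.
pose Q := (N %/ s.+1).+1.
have Q0Q : (Q0 <= Q)%N by rewrite /Q ltnW// ltnS leq_divRL.
have NQ : (N <= Q * s.+1)%N by rewrite ltnW// ltn_ceil.
have QN : (Q.-1 * s.+1 <= N)%N by rewrite leq_trunc_div.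
have s0 : (0:R) < s.+1%:R by [].
have [r rs hr] : exists2 r : 'I_s.+1, true &
    d * Q.-1%:R * s.+1%:R < \sum_(i < Q) g (r + i * s.+1)%N s.+1 (x (r + i * s.+1)%N).
  apply: contrapT => /forall2NP h.
  have : \sum_(n < Q * s.+1) g n s.+1 (x n) <= d * Q.-1%:R * s.+1%:R * s.+1%:R.
    rewrite (sum_progressions _ _ (fun n => g n s.+1 (x n))).
    rewrite [leRHS](_ : _ = \sum_(r < s.+1) d * Q.-1%:R * s.+1%:R); last first.
      by rewrite sumr_const card_ord mulr_natr.
    by apply: ler_sum => r _; have [//|/negP] := h r; rewrite -leNgt.
  apply/negP; rewrite -ltNge.
  apply: le_lt_trans (lt_le_trans hx _).
    rewrite ler_pM2r// -mulrA ler_pM2l// -natrM ler_nat//.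
  rewrite (big_ord_widen _ (fun n => g n s.+1 (x n)) NQ)
    [leRHS](bigID (fun i : 'I__ => (i < N)%N)) /=.
  by rewrite lerDl sumr_ge0.
exists (Q, val r, x); split => /=.
- by apply: leq_trans Q0Q; rewrite /Q0; lia.
- by rewrite -ltnS.
have MQ : (M.+1 <= Q)%N by apply: leq_trans Q0Q; rewrite /Q0; lia.
have : \sum_(i < Q) g (r + i * s.+1)%N s.+1 (x (r + i * s.+1)%N) <=
   C * s.+1%:R * M.+1%:R +
   \sum_(M.+1 <= i < Q) g (r + i * s.+1) s.+1 (x (r + i * s.+1)%N).
  rewrite -(big_mkord xpredT (fun i => g (r + i * s.+1)%N s.+1 (x (r + i * s.+1)%N))).
  rewrite (big_cat_nat (n := M.+1))//= lerD2r.
  rewrite [leRHS](_ : _ = \sum_(0 <= i < M.+1) C * s.+1%:R).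
    by apply: ler_sum.
  by rewrite sumr_const_nat subn0 mulr_natr.
rewrite -lerBlDl; apply: le_trans.
rewrite lerBrDr; apply: le_trans (ltW hr).
have -> : C * s.+1%:R * M.+1%:R = C * M.+1%:R * s.+1%:R by rewrite mulrAC.
apply: (@le_trans _ _ ((d / 2 * (Q%:R + 1) + C * M.+1%:R) * s.+1%:R)).
  rewrite [leRHS]mulrDl lerD2r -[leRHS]mulrA ler_pM2l ?divr_gt0//.
  rewrite natrD natrM mulrDl mul1r addrC lerD2l ler_nat.
  by rewrite ltnW.
rewrite ler_pM2r//.
have -> : Q.-1%:R = Q%:R - 1 :> R by rewrite -[in RHS](prednK (n := Q))// -natr1 addrK.
have : (3 * d / 2 + C * M.+1%:R) / (d / 2) <= Q%:R.
  apply: (@le_trans _ _ Q0%:R); last by rewrite ler_nat.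
  by rewrite (le_trans (ltW (truncnS_gt _)))// ler_nat /Q0 ltnS leq_addl.
rewrite ler_pdivrMr ?divr_gt0//; lra.
Qed.

Variable D : nat * nat -> nat * nat * (nat -> X).
Hypothesis DP : forall p, rich_progression p.1 p.2 (D p).

(* The pair (s, j) stands for the j-th cut of stage s: first the end M of the
   previous stage, then the terms of the progression chosen for s and M, whose
   end is the beginning of stage s + 1. *)
Fixpoint stage_start s :=
  if s is t.+1 then let y := (D (t, stage_start t)).1 in (y.2 + y.1 * t.+1)%N else 0%N.

Let M := stage_start.
Let Q s := (D (s, M s)).1.1.
Let r s := (D (s, M s)).1.2.
Let xs s := (D (s, M s)).2.
Let len s := (Q s - M s)%N.

Let MS s : M s.+1 = (r s + Q s * s.+1)%N. Proof. by []. Qed.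

Let len_ge s : (2 < len s)%N.
Proof. by rewrite /len /Q; have [/=+ _ _] := DP (s, M s); lia. Qed.

Let lenS s : (M s + len s = Q s)%N.
Proof. by have := len_ge s; rewrite /len; lia. Qed.

Definition cut (p : nat * nat) :=
  if p.2 is j.+1 then (r p.1 + (M p.1 + 1 + j) * p.1.+1)%N else M p.1.

Definition next_cut (p : nat * nat) :=
  if (p.2.+1 < len p.1)%N then (p.1, p.2.+1) else (p.1.+1, 0%N).

Definition cuts k := iter k next_cut (0%N, 0%N).

Let cuts_len k : ((cuts k).2 < len (cuts k).1)%N.
Proof.
elim: k => [|k IH] /=; first by have := len_ge 0; lia.
rewrite /next_cut; case: ifP => //= _.
by have := len_ge (cuts k).1.+1; lia.
Qed.

(** One step beyond the last term of stage s, the formula of [cut] gives r + Q (s + 1), which is the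
    start of stage s + 1; a change of stage thus needs no separate treatment. *)
Let cut_next k : cut (cuts k.+1) = cut ((cuts k).1, (cuts k).2.+1).
Proof.
rewrite /= /next_cut; have := cuts_len k; case: (cuts k) => s j /= jl.
case: ifPn => //; rewrite -leqNgt => lj.
have {jl lj} e : j.+1 = len s by lia.
rewrite [LHS](MS s) /cut /=; congr (_ + _ * _)%N.
by rewrite -lenS -e; lia.
Qed.

(** The position M serves also as the threshold for the index i. The first kept term r + (M + 1)(s +
    1) is therefore at least M + (s + 1), and the joining block is long enough too. *)
Let cut_gap s j : (cut (s, j) + s.+1 <= cut (s, j.+1))%N.
Proof. by case: j => [|j]; rewrite /cut /=; nia. Qed.

Let b k := cut (cuts k).

Let b_gap k : (b k + (cuts k).1.+1 <= b k.+1)%N.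
Proof. by rewrite /b cut_next; have := cut_gap (cuts k).1 (cuts k).2; case: (cuts k). Qed.

Let cuts_run s K j : cuts K = (s, 0%N) -> (j < len s)%N -> cuts (K + j) = (s, j).
Proof.
move=> KE; elim: j => [|j IH] jl; first by rewrite addn0.
rewrite addnS /= IH; last by lia.
by rewrite /next_cut /= jl.
Qed.

Let cuts_succ s K : cuts K = (s, 0%N) -> cuts (K + len s) = (s.+1, 0%N).
Proof.
have l2 := len_ge s; move=> KE.
rewrite -[len s]prednK ?addnS /=; last by lia.
rewrite (cuts_run KE); last by lia.
by rewrite /next_cut /= prednK ?ltnn//; lia.
Qed.

Let cuts_stage s : exists K, cuts K = (s, 0%N).
Proof.
elim: s => [|s [K KE]]; first by exists 0%N.
by exists (K + len s)%N; exact: cuts_succ.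
Qed.

Let cuts_mono k l : (k <= l)%N -> ((cuts k).1 <= (cuts l).1)%N.
Proof.
move=> /subnK <-; elim: (l - k)%N => //= n IH; apply: (leq_trans IH).
by rewrite /next_cut; case: ifP => //=.
Qed.

Let cuts_le k : ((cuts k).1 <= k)%N.
Proof. by elim: k => //= k IH; rewrite /next_cut; case: ifP => //= _; lia. Qed.

(** When stage n ends, its progression alone, without the earlier stages and the joining block,
    makes the average at least d / 2. This happens for every n, so the average does not tend to 0,
    although the block lengths do tend to infinity. *)
Lemma rich_progressions_absurd : False.
Proof.
have b0 : b 0 = 0%N by [].
have bm : {homo b : k l / (k < l)%N}.
  apply: homo_ltn; first exact: ltn_trans.
  by move=> k; have := b_gap k; lia.
have bg : (b k.+1 - b k)%N @[k --> \oo] --> \oo.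
  move=> A [n _ nA]; have [K KE] := cuts_stage n.
  exists K => // k /= Kk; apply: nA => /=.
  by have := b_gap k; have := cuts_mono Kk; rewrite KE /=; lia.
have := g_blocks (fun k => xs (cuts k).1 (b k)) b0 bm bg.
move=> /cvgrPdist_lt /(_ (d / 2)); rewrite divr_gt0// => /(_ isT) [n _ hn].
have [K KE] := cuts_stage n; have l2 := len_ge n.
have nK : (n <= K)%N by have := cuts_le K; rewrite KE.
have KE' := cuts_succ KE.
have := hn (K + len n)%N; rewrite /= (leq_trans nK) ?leq_addr// => /(_ isT).
apply/negP; rewrite -leNgt sub0r normrN.
rewrite ger0_norm; last by rewrite mulr_ge0 ?invr_ge0 ?sumr_ge0.
have bE : b (K + len n) = (r n + Q n * n.+1)%N by rewrite /b KE' -MS.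
have [_ _] := DP (n, M n); rewrite -/(Q n) -/(r n) -/(xs n) -/(M n) /= => hs.
rewrite bE ler_pdivlMl; last first.
  by rewrite ltr0n addn_gt0 muln_gt0 -lenS addn_gt0 (ltn_trans _ l2) ?orbT.
rewrite mulrC (le_trans hs)//.
rewrite big_split_ord /= ler_wpDl ?sumr_ge0//.
rewrite -[X in _ <= X](big_mkord xpredT (fun j => g (b (K + j)) (b (K + j).+1 - b (K + j))
  (xs (cuts (K + j)).1 (b (K + j))))).
rewrite [leRHS]big_ltn; last exact: ltn_trans l2.
apply: ler_wpDl => //.
rewrite -(addn0 1%N) (addnC 1%N) -(add0n (M n).+1) !big_addn.
rewrite (_ : Q n - (M n).+1 = len n - 1)%N; last by rewrite -lenS; lia.
rewrite big_nat [leRHS]big_nat ler_sum// => j /= jl.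
have -> : cuts (K + (j + 1)) = (n, j.+1) by rewrite (cuts_run KE) ?addn1//; lia.
have bj : b (K + (j + 1)) = (r n + (j + (M n).+1) * n.+1)%N.
  by rewrite /b (cuts_run KE) ?addn1 /cut//=; lia.
have bj1 : b (K + (j + 1)).+1 = (r n + (j + (M n).+1) * n.+1 + n.+1)%N.
  rewrite /b cut_next (cuts_run KE) ?addn1 /cut//=; last by lia.
  by rewrite -[RHS]addnA -mulSnr; congr (_ + _ * _)%N; lia.
by rewrite bj1 bj addKn.
Qed.
End Refutation.

(** The negation provides rich progressions for every pair (s, M). They are selected by a function
    of both, because the M met at a stage depends on the selections made before. *)
Lemma block_sums_negligible d : 0 < d ->
  exists H, exists N0, forall N (x : nat -> X), (N0 <= N)%N ->
    \sum_(n < N) g n H.+1 (x n) <= d * N%:R * H.+1%:R.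
Proof.
move=> d0; apply: contrapT => hn.
have hD : forall p : nat * nat, exists y, rich_progression d p.1 p.2 y.
  case=> s M; apply: exists_rich_progression => // N0.
  apply: contrapT => hN; apply: hn; exists s, N0 => N x N0N.
  by rewrite leNgt; apply/negP => hx; apply: hN; exists N, x.
have [D DP] := choice hD.
exact: rich_progressions_absurd DP.
Qed.
End Blocks.

(** * The space of bi-infinite sequences as a continuous image of the Cantor space *)

Section ComplexModulus.
Context {R : realType}.
Implicit Types z w : R[i].

(** The norm of [R[i]] has values in [R[i]]; this is the same number as an element of [R], where
    real limits and linear arithmetic apply. *)
Definition modulus z : R := complex.Re `|z|.

Lemma modulusE z : `|z| = ((modulus z)%:C)%C.
Proof. by rewrite /modulus normc_def. Qed.

Lemma modulus_ge0 z : 0 <= modulus z.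
Proof. by rewrite -lecR -modulusE normr_ge0. Qed.

Lemma modulusD z w : modulus (z + w) <= modulus z + modulus w.
Proof. by rewrite -lecR rmorphD -!modulusE ler_normD. Qed.

Lemma modulusM z w : modulus (z * w) = modulus z * modulus w.
Proof. by apply: complexI; rewrite rmorphM -!modulusE normrM. Qed.

Lemma modulus0 : modulus 0 = 0.
Proof. by rewrite /modulus normr0. Qed.

Lemma modulusN z : modulus (- z) = modulus z.
Proof. by rewrite /modulus normrN. Qed.

Lemma modulusJ z : modulus z^* = modulus z.
Proof. by rewrite /modulus norm_conjC. Qed.

Lemma modulus_sum I (r : seq I) (P : pred I) (F : I -> R[i]) :
  modulus (\sum_(i <- r | P i) F i) <= \sum_(i <- r | P i) modulus (F i).
Proof.
elim/big_rec2 : _ => [|i x y _ h]; first by rewrite modulus0.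
by rewrite (le_trans (modulusD _ _))// lerD2l.
Qed.

Lemma modulus_le_ReIm z :
  modulus z <= `|complex.Re z| + `|complex.Im z|.
Proof.
rewrite /modulus normc_def /=; case: z => a b /=.
rewrite -(ler_pXn2r (n := 2)) ?nnegrE ?sqrtr_ge0 ?addr_ge0//.
rewrite sqr_sqrtr ?addr_ge0 ?sqr_ge0// sqrrD !real_normK ?num_real//.
by rewrite lerD2r lerDl mulrn_wge0 ?mulr_ge0.
Qed.

Lemma Re_le_modulus z : `|complex.Re z| <= modulus z.
Proof. by have := normc_ge_Re z; rewrite modulusE lecR. Qed.

Lemma Im_le_modulus z : `|complex.Im z| <= modulus z.
Proof.
rewrite /modulus normc_def /=; case: z => a b /=.
by rewrite -sqrtr_sqr ler_sqrt ?addr_ge0 ?sqr_ge0// lerDr sqr_ge0.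
Qed.

Lemma complex_cvg0P (T : Type) (F : set_system T) {FF : Filter F} (f : T -> R[i]^o) :
  (f @ F --> (0 : R[i]^o)) <-> (modulus (f x) @[x --> F] --> (0 : R)).
Proof.
split.
- move=> /cvgrPdist_lt h; apply/cvgrPdist_lt => e e0.
  have e0' : 0 < (e%:C)%C :> R[i] by rewrite ltcR.
  move: (h _ e0'); apply: filterS => x.
  by rewrite !sub0r !normrN modulusE ltcR ger0_norm ?modulus_ge0.
- move=> /cvgrPdist_lt h; apply/cvgrPdist_lt => e e0.
  have e0' : 0 < complex.Re e by move: e0; rewrite ltcE /= => /andP[].
  move: (h _ e0'); apply: filterS => x.
  rewrite !sub0r !normrN modulusE ger0_norm ?modulus_ge0// => xe.
  by rewrite ltcE /= xe andbT; move: e0; rewrite ltcE /= => /andP[].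
Qed.

Lemma complex_cvgP (T : Type) (F : set_system T) {FF : Filter F} (f : T -> R[i]^o) z :
  (f @ F --> (z : R[i]^o)) <->
  (complex.Re (f x) @[x --> F] --> complex.Re z) /\
  (complex.Im (f x) @[x --> F] --> complex.Im z).
Proof.
apply: (iff_trans (iff_sym (@subr_cvg0 R[i] R[i]^o T F FF f z))).
apply: (iff_trans (@complex_cvg0P _ _ FF _)); split.
- move=> h; split; rewrite -subr_cvg0; apply: norm_cvg0;
    apply: (squeeze_cvgr _ (cvg_cst 0) h); near=> x; rewrite normr_ge0 /=.
  + by have := Re_le_modulus (f x - z); case: (f x) => a b; case: z {h}.
  + by have := Im_le_modulus (f x - z); case: (f x) => a b; case: z {h}.
- case=> hr hi.
  have {}hr : `|complex.Re (f x) - complex.Re z| @[x --> F] --> (0 : R).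
    rewrite -(normr0 R) -(subrr (complex.Re z)); apply: cvg_norm.
    by apply: cvgB => //; exact: cvg_cst.
  have {}hi : `|complex.Im (f x) - complex.Im z| @[x --> F] --> (0 : R).
    rewrite -(normr0 R) -(subrr (complex.Im z)); apply: cvg_norm.
    by apply: cvgB => //; exact: cvg_cst.
  have h : `|complex.Re (f x) - complex.Re z| + `|complex.Im (f x) - complex.Im z|
      @[x --> F] --> (0 : R).
    by rewrite -[X in _ --> X]addr0; exact: cvgD.
  apply: (squeeze_cvgr _ (cvg_cst 0) h); near=> x; rewrite modulus_ge0 /=.
  by have := modulus_le_ReIm (f x - z); case: (f x) => a b; case: z {h hr hi}.
Unshelve. all: by end_near. Qed.

End ComplexModulus.

Section InitialTopology.

Lemma cvg_initial (S : choiceType) (T : topologicalType) (f : S -> T)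
  (F : set_system S) (s : initial_topology f) : Filter F ->
  f @ F --> f s -> F --> s.
Proof.
move=> FF h A [_ [[B oB <-] Bs BA]].
by apply: (filterS BA); apply: h; exact: open_nbhs_nbhs.
Qed.

Lemma continuous_set_type (U T : topologicalType) (A : set T) (h : U -> set_type A) :
  continuous (fun x => set_val (h x)) -> continuous h.
Proof.
move=> ch x; apply: (@cvg_initial _ _ (@set_val T A)); exact: ch.
Qed.

Lemma continuous_set_val (T : topologicalType) (A : set T) :
  continuous (@set_val T A).
Proof. exact: initial_continuous. Qed.

Lemma continuous_ptws (U : topologicalType) (I : eqType) (T : topologicalType)
  (h : U -> {ptws I -> T}) : (forall i, continuous (fun x => h x i)) -> continuous h.
Proof.
move=> ch x; apply/cvg_sup => i.
apply: (@cvg_initial _ _ (fun f : I -> T => f i)); exact: ch.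
Qed.

Lemma cvg_max (R : realType) (T : Type) (F : set_system T) {FF : Filter F}
   (f g : T -> R) a b :
  f @ F --> a -> g @ F --> b -> Num.max (f x) (g x) @[x --> F] --> Num.max a b.
Proof.
move=> fa gb; under eq_fun do rewrite maxr_absE; rewrite maxr_absE.
apply: cvgM; last exact: cvg_cst.
apply: cvgD; first exact: cvgD.
by apply: cvg_norm; exact: cvgB.
Qed.

End InitialTopology.

Section CantorBiseq.
Context {R : realType} (L : {posnum R}).

Definition side := set_type (`[- L%:num, L%:num]%classic : set R).

(** The retraction of the line onto [-L, L]. The minimum of x and L is written as a negated maximum,
    so that [cvg_max] suffices for continuity. *)
Definition clamp (x : R) := Num.max (- L%:num) (- Num.max (- x) (- L%:num)).

Lemma clampP x : (`[- L%:num, L%:num]%classic : set R) (clamp x).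
Proof.
have L0 : 0 <= L%:num by [].
rewrite /= in_itv /=; apply/andP; rewrite /clamp; split.
  by rewrite le_max lexx.
by rewrite ge_max; apply/andP; split; [lra|rewrite lerNl le_max lexx orbT].
Qed.

Definition to_side x : side := exist _ (clamp x) (mem_set (clampP x)).

HB.instance Definition _ := PseudoMetric.on side.
HB.instance Definition _ := isPointed.Build side (to_side 0).

Lemma to_side_continuous : continuous to_side.
Proof.
apply: continuous_set_type => x /=; rewrite set_valE /=.
apply: cvg_max; first exact: cvg_cst.
by apply: cvgN; apply: cvg_max; [apply: cvgN|exact: cvg_cst].
Qed.

Lemma to_sideK (x : R) : - L%:num <= x <= L%:num -> set_val (to_side x) = x.
Proof.
move=> /andP[Lx xL]; rewrite set_valE /= /clamp.
by rewrite (@max_l _ _ (- x)) ?lerN2// opprK max_r.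
Qed.

Lemma side_compact : compact [set: side].
Proof.
rewrite (_ : setT = to_side @` `[- L%:num, L%:num]).
  apply: continuous_compact; last exact: segment_compact.
  by apply: continuous_subspaceT; exact: to_side_continuous.
apply/seteqP; split => // -[x xL] _; exists x; first by rewrite inE in xL.
apply: val_inj; have := @to_sideK x; rewrite set_valE /=; apply.
by rewrite inE /= in_itv /= in xL.
Qed.

Lemma side_hausdorff : hausdorff_space side.
Proof.
move=> p q pq; apply: val_inj.
apply: (@norm_hausdorff _ R) => A B nA nB.
have [z [/= Az Bz]] := pq (set_val @^-1` A) (set_val @^-1` B)
  (@continuous_set_val _ _ p _ nA) (@continuous_set_val _ _ q _ nB).
by exists (set_val z).
Qed.

(* The theorem that compact metric spaces are images of the Cantor space is
   applied to the segment [-L, L] only; the coordinates of a bi-infinite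
   sequence are then read off disjoint subsequences of one binary sequence. *)
Lemma cantor_side : exists2 g : cantor_space -> side, continuous g & forall x,
  exists z, g z = x.
Proof.
have [g cg] := cantor_surj side_compact side_hausdorff.
by exists g => // x; have [z _ <-] := @surj _ _ _ _ g x I; exists z.
Qed.

(** Real and imaginary parts coded separately fill a square; multiplying both by this ratio is the
    radial retraction onto the disc. *)
Let ratio (a b : R) := L%:num / Num.max L%:num (Num.sqrt (a ^+ 2 + b ^+ 2)).

Let clamp2 (a b : R) : R[i]^o := ((a * ratio a b) +i* (b * ratio a b))%C.

Let clamp2P a b : [set z : R[i]^o | `|z| <= ((L%:num)%:C)%C] (clamp2 a b).
Proof.
have L0 : 0 < L%:num by [].
have m0 : 0 < Num.max L%:num (Num.sqrt (a ^+ 2 + b ^+ 2)) by rewrite lt_max L0.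
have r0 : 0 <= ratio a b by rewrite divr_ge0 // ltW.
rewrite /= normc_def /= lecR (exprMn 2 a) (exprMn 2 b)
  -mulrDl sqrtrM ?addr_ge0 ?sqr_ge0//.
rewrite sqrtr_sqr ger0_norm// /ratio mulrCA ger_pMr// ler_pdivrMr// mul1r.
by rewrite le_max lexx orbT.
Qed.

Let to_disc a b : disc L := exist _ (clamp2 a b) (mem_set (clamp2P a b)).

Let ratio_cvg (T : Type) (F : set_system T) (FF : Filter F) (f g : T -> R) a b :
  f @ F --> a -> g @ F --> b -> ratio (f x) (g x) @[x --> F] --> ratio a b.
Proof.
move=> fa gb; apply: cvgM; first exact: cvg_cst.
apply: cvgV; first by rewrite gt_eqF// lt_max gt0.
apply: cvg_max; first exact: cvg_cst.
by apply: continuous_cvg; [exact: sqrt_continuous|apply: cvgD; apply: cvgM].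
Qed.

Let to_discK (z : disc L) :
  to_disc (complex.Re (set_val z)) (complex.Im (set_val z)) = z.
Proof.
apply: val_inj => /=; case: z => -[a b] zL /=.
rewrite /clamp2 /ratio max_l ?divff ?mulr1//.
by rewrite inE /= normc_def /= lecR in zL.
Qed.

Definition unpair (i : int * bool) (w : cantor_space) : cantor_space :=
  fun k => w (pickle (i, k)).

Lemma unpair_continuous i : continuous (unpair i).
Proof.
apply: continuous_ptws => k; exact: (@proj_continuous nat (fun=> bool)).
Qed.

Lemma cantor_biseq : exists2 f : cantor_space -> biseq L, continuous f &
  forall w, exists z, f z = w.
Proof.
have [g cg gsurj] := cantor_side.
pose coord n b w := set_val (g (unpair (n, b) w)).
have ccoord n b : continuous (coord n b).
  move=> w; apply: continuous_comp; last exact: continuous_set_val.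
  by apply: continuous_comp; [exact: unpair_continuous|exact: cg].
exists (fun w n => to_disc (coord n false w) (coord n true w)).
  apply: continuous_ptws => n; apply: continuous_set_type => w.
  rewrite set_valE /=.
  by apply/complex_cvgP; split => /=; apply: cvgM; try exact: ccoord;
    apply: ratio_cvg; exact: ccoord.
move=> w.
have [W WP] := choice (fun p : int * bool =>
  gsurj (to_side (if p.2 then complex.Im (entry w p.1) else complex.Re (entry w p.1)))).
exists (fun k => if unpickle k is Some (i, j) then W i j else false).
have mw n : modulus (entry w n) <= L%:num.
  by have := set_valP (w n); rewrite /= modulusE lecR.
have WE i : unpair i (fun k => if unpickle k is Some (i, j) then W i j else false) = W i.
  by apply/funext => k; rewrite /unpair pickleK.
apply/funext => n; rewrite /coord !WE !WP !to_sideK ?to_discK// -ler_norml.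
  exact: le_trans (Im_le_modulus _) (mw n).
exact: le_trans (Re_le_modulus _) (mw n).
Qed.

End CantorBiseq.

(** * Weak-* limit points of empirical measures *)

Section PointwiseSubsequence.
Context {R : realType} {J : countType}.

(** Tychonoff's theorem gives a cluster point of the tails in [0, 1]^J. As J is countable, the k-th
    neighbourhood need only constrain the indices with code at most k, up to 1/(k + 1); choosing
    successively inside these neighbourhoods gives the subsequence. The set [B] lets it be taken
    among prescribed times. *)
Lemma pointwise_subsequence (p_ : nat -> J -> R) (B : set nat) :
  (forall N i, 0 <= p_ N i <= 1) -> (forall n, exists2 N, (n < N)%N & B N) ->
  exists p : J -> R, exists N : nat -> nat,
    [/\ {homo N : i j / (i < j)%N}, forall k, B (N k) &
        forall i, p_ (N k) i @[k --> \oo] --> p i].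
Proof.
move=> p01 Binf.
pose F := filter_from [set: nat] (fun n => [set p_ N | N in [set N | (n < N)%N /\ B N]]).
have FF : ProperFilter F.
  apply: filter_from_proper; last first.
    by move=> n _; have [N nN BN] := Binf n; exists (p_ N), N.
  apply: filter_from_filter; first by exists 0%N.
  move=> m n _ _; exists (maxn m n) => // _ [N [+ BN] <-].
  by rewrite gtn_max => /andP[mN nN]; split; exists N.
have := @tychonoff J (fun=> R) (fun=> `[0, 1]%classic) (fun=> @segment_compact R 0 1).
move=> /(_ F FF) [].
  exists 0%N => // _ [N _ <-] i /=; rewrite in_itv/=; exact: p01.
move=> p [_ clp]; exists p.
have pick k n : exists N, [/\ (n < N)%N, B N & forall i, (pickle i <= k)%N ->
    `|p i - p_ N i| < k.+1%:R^-1].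
  pose near_p (j : 'I_k.+1) : set {ptws J -> R} :=
    if unpickle j is Some i then [set q | `|p i - q i| < k.+1%:R^-1] else setT.
  have : nbhs (p : {ptws J -> R}) [set q | forall j, near_p j q].
    have Fp : Filter (nbhs (p : {ptws J -> R})) by exact: nbhs_filter.
    apply: (filter_forall Fp) => j; rewrite /near_p.
    case: (unpickle j) => [i|]; last exact: filterT.
    have /cvgrPdist_lt := @proj_continuous J (fun=> R) i p.
    by move=> /(_ k.+1%:R^-1); rewrite invr_gt0 ltr0n => /(_ isT).
  have FB : F [set p_ N | N in [set N | (n < N)%N /\ B N]] by exists n.
  move=> /(clp _ _ FB) [_ [[N [nN BN] <-] h]].
  exists N; split => // i ik; have := h (Ordinal (ik : (pickle i < k.+1)%N)).
  by rewrite /near_p /= pickleK.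
have [D DP] := choice (fun kn : nat * nat => pick kn.1 kn.2).
pose N := fix N k := if k is j.+1 then D (k, N j) else D (0, 0)%N.
have NP k : [/\ (if k is j.+1 then N j < N k else true)%N, B (N k) & forall i,
  (pickle i <= k)%N ->
    `|p i - p_ (N k) i| < k.+1%:R^-1].
  by case: k => [|k]; [have [] := DP (0, 0)%N | have [] := DP (k.+1, N k)].
exists N; split => [|k|i].
- by apply: homo_ltn; [exact: ltn_trans|move=> k; have [] := NP k.+1].
- by have [] := NP k.
- apply/cvgrPdist_lt => e e0.
  exists (pickle i + Num.truncn e^-1)%N => // k /= ik.
  have [_ _ /(_ i)] := NP k; rewrite (leq_trans (leq_addr _ _) ik) => /(_ isT).
  move=> /lt_le_trans; apply; rewrite invf_ple ?posrE ?ltr0n//.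
  rewrite (le_trans (ltW (truncnS_gt _)))// ler_nat ltnS.
  exact: leq_trans (leq_addl _ _) ik.
Qed.

End PointwiseSubsequence.

Lemma nbhs_cantor (w : cantor_space) (V : set cantor_space) : nbhs w V ->
  exists k, forall w' : cantor_space, mkseq w' k = mkseq w k -> V w'.
Proof.
move=> wV; apply: contrapT => /forallNP h.
have {}h k : exists w' : cantor_space, mkseq w' k = mkseq w k /\ ~ V w'.
  by have /existsNP[w' /not_implyP ?] := h k; exists w'.
have [W WP] := choice h.
have : W @ \oo --> w.
  apply/cvg_sup => i.
  apply: (@cvg_initial _ _ (fun f : nat -> bool => f i)) => A wA.
  exists i.+1 => // k /= ik.
  have [/(congr1 (fun s => nth false s i))] := WP k.
  by rewrite !nth_mkseq// => -> _; exact: nbhs_singleton wA.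
by move=> /(_ _ wV) [k _ /(_ k (leqnn k))]; have [_] := WP k.
Qed.

(** Otherwise take bad pairs that agree on n digits, and a cluster point w of their first
    components. For large n both components agree with w on the digits that determine g up to e /
    2. *)
Lemma cantor_uniform (R : realType) (g : cantor_space -> R) (e : R) :
  continuous g -> 0 < e ->
  exists k, forall w w' : cantor_space, mkseq w' k = mkseq w k -> `|g w' - g w| < e.
Proof.
move=> cg e0; apply: contrapT => /forallNP h.
have {}h k : exists ww' : cantor_space * cantor_space,
    mkseq ww'.2 k = mkseq ww'.1 k /\ e <= `|g ww'.2 - g ww'.1|.
  have /existsNP[w /existsNP[w' /not_implyP [ww' /negP]]] := h k.
  by rewrite -leNgt; exists (w, w').
have [W WP] := choice h.
have [|w [_ clw]] := cantor_space_compact (fmap_proper_filter (fst \o W)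
  eventually_filter).
  exact: filterT.
have : nbhs w [set w' | `|g w - g w'| < e / 2].
  by move/cvgrPdist_lt : (cg w); apply; rewrite divr_gt0.
move=> /nbhs_cantor[k hk].
have : nbhs w [set w' | mkseq w' k = mkseq w k].
  have : nbhs w [set w' : cantor_space | forall i : 'I_k, w' i = w i].
    have Fw : Filter (nbhs w) by exact: nbhs_filter.
    apply: (filter_forall (f := fun (i : 'I_k) (w' : cantor_space)
      => w' i = w i) Fw) => i.
    apply: (@proj_continuous nat (fun=> bool) i w [set b | b = w i]).
    exact: discrete_set1.
  apply: filterS => w' ww'; apply: (@eq_from_nth _ false); rewrite !size_mkseq// => i ik.
  by rewrite !nth_mkseq// (ww' (Ordinal ik)).
have FW : (fst \o W @ \oo) [set (W n).1 | n in [set n | (k <= n)%N]].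
  by exists k => // n /= kn; exists n.
move=> /(clw _ _ FW)[_ [[n /= kn <-]] w1]; have [w21 ] := WP n.
apply/negP; rewrite -ltNge.
have w2 : mkseq (W n).2 k = mkseq w k.
  have /(congr1 (take k)) := w21; rewrite -!map_take take_iota (minn_idPl kn).
  by move=> e12; rewrite /mkseq e12.
have := hk _ w1; have := hk _ w2 => /=.
set a := g w; set b := g (W n).2; set c := g (W n).1.
by rewrite !ltr_norml => /andP[? ?] /andP[? ?]; lra.
Qed.

(** * Measures with prescribed masses of binary cylinders *)

Section BinaryAddress.
Context {R : realType} (p : seq bool -> R).
Hypotheses (p_ge0 : forall s, 0 <= p s) (p_nil : p [::] = 1)
  (p_rcons : forall s, p s = p (rcons s false) + p (rcons s true)).

(* [0, 1[ is split into consecutive intervals of lengths p s, one for each binary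
   word s of given length; locate k t is the word of length k whose interval
   contains t, with the left endpoint of this interval. *)
Fixpoint locate k (t : R) : seq bool * R :=
  if k is j.+1 then
    let: (s, a) := locate j t in let c := a + p (rcons s false) in
    if t < c then (rcons s false, a) else (rcons s true, c)
  else ([::], 0).

Definition address (t : R) : cantor_space := fun k => last false (locate k.+1 t).1.

Lemma locate_address k t : (locate k t).1 = mkseq (address t) k.
Proof.
elim: k => [//|k IH]; rewrite mkseqS -IH /address /=.
by case: (locate k t) => s a /=; case: ifP; rewrite last_rcons.
Qed.

(** Appending a letter cuts the interval of s at a + p (s0). The fourth clause is restricted to [0,
    1[ because [locate] is total: negative points follow the leftmost branch, points beyond 1 the
    rightmost one. *)
Lemma locate_spec s : exists a,
  [/\ 0 <= a, a + p s <= 1,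
    forall t, (locate (size s) t).1 = s -> (locate (size s) t).2 = a,
    forall t, 0 <= t < 1 -> ((locate (size s) t).1 == s) = (a <= t < a + p s) &
    measurable [set t | (locate (size s) t).1 = s]].
Proof.
elim/last_ind: s => [|s b [a [a0 a1 la lat mla]]].
  exists 0; rewrite p_nil add0r; split => //.
  by rewrite [X in measurable X](_ : _ = setT)//; apply/seteqP; split.
have q0 := p_ge0 (rcons s false); have q1 := p_ge0 (rcons s true).
have ps := p_rcons s; rewrite size_rcons.
have step t c : (locate (size s).+1 t).1 = rcons s c <->
    (locate (size s) t).1 = s /\ c = ~~ (t < a + p (rcons s false)).
  move=> /=; have := la t; case: (locate (size s) t) => s' a' /= h.
  split.
    by case: ifP => ta /= /rcons_inj [ss' <-]; move: (h ss') ta => <-; rewrite ss' => ->.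
  by move=> [ss' ->]; rewrite (h ss') ss'; case: ifP.
exists (if b then a + p (rcons s false) else a); split.
- by case: b => //; rewrite addr_ge0.
- by case: b; lra.
- move=> t /step [ss' bE]; move: (la t ss') bE => /=;
  case: (locate _ _) ss' => s' a' /= -> ->.
  by case: ifP => ta -> //=.
- move=> t t01; have := lat t t01 => lt.
  apply/idP/idP.
    move=> /eqP /step [/eqP]; rewrite lt => /andP[h1 h2].
    by case: b; case: (ltP t (a + p (rcons s false))) => //= h3 _; lra.
  move=> h; apply/eqP/step; split.
    by apply/eqP; rewrite lt; case: b h => /andP[*]; lra.
  by case: b h => /andP[h1 h2]; case: ltP => //; lra.
- rewrite (_ : [set t | _] = [set t | (locate (size s) t).1 = s] `&`
      (if b then `[a + p (rcons s false), +oo[ else `]-oo,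
        a + p (rcons s false)[)%classic).
    by apply: measurableI => //; case: b.
  apply/seteqP; split => t /=.
    by move=> /step [-> ->]; split => //; case: ltP; rewrite /= in_itv//= andbT.
  move=> [ls h]; apply/step; split => //.
  by case: b h; rewrite /= in_itv/= ?andbT; case: ltP.
Qed.

Definition unit_itv_prob := mrestr (@lebesgue_measure R) (measurable_itv `[0:R, 1:R[).

HB.instance Definition _ := Measure.on unit_itv_prob.

Let unit_itv_prob_setT : unit_itv_prob setT = 1%E.
Proof.
by rewrite /unit_itv_prob /mrestr setTI lebesgue_measure_itv/= lte_fin ltr01 oppr0 adde0.
Qed.

HB.instance Definition _ := Measure_isProbability.Build _ _ _ unit_itv_prob
  unit_itv_prob_setT.

Lemma unit_itv_prob_address s :
  unit_itv_prob [set t | mkseq (address t) (size s) = s] = (p s)%:E.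
Proof.
have [a [a0 a1 _ lat _]] := locate_spec s.
rewrite /unit_itv_prob /mrestr [X in lebesgue_measure X](_ : _ = `[a, a + p s[%classic).
  rewrite lebesgue_measure_itv /= lte_fin ltrDl; case: ltP => ps.
    by rewrite -EFinD addrAC subrr add0r.
  by congr EFin; apply/eqP; rewrite eq_le ps p_ge0.
apply/seteqP; split => t /=; rewrite !in_itv/=.
  by move=> [/eqP + t01]; rewrite -locate_address lat.
move=> h; have t01 : 0 <= t < 1 by case/andP: h; lra.
by split => //; apply/eqP; rewrite -locate_address lat.
Qed.

Lemma measurable_address s : measurable [set t | mkseq (address t) (size s) = s].
Proof.
have [a [_ _ _ _]] := locate_spec s.
by congr measurable; apply/seteqP; split => t /=; rewrite locate_address.
Qed.

(** An open set of the Cantor space is a union of cylinders, and there are only countably many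
    words; the union is indexed by their codes. *)
Lemma measurable_fun_address (T : ptopologicalType) (pi : cantor_space -> T) :
  continuous pi -> measurable_fun setT (pi \o address : R -> borel T).
Proof.
move=> cpi; apply: (@measurability _ _ _ (borel T) setT _ (@open T)) => //.
move=> _ [U oU <-].
pose cylinders (o : option (seq bool)) : set R :=
  if o is Some s then
    if `[< forall w : cantor_space, mkseq w (size s) = s -> U (pi w) >] then
      [set t | mkseq (address t) (size s) = s] else set0
  else set0.
have mcyl o : measurable (cylinders o).
  by case: o => //= s; case: ifP => // _; exact: measurable_address.
rewrite setTI (_ : _ @^-1` U = \bigcup_n cylinders (unpickle n)).
  exact: bigcupT_measurable.
apply/seteqP; split => [t /= Ut|t [n _]].
  have /nbhs_cantor[k hk] : nbhs (address t) (pi @^-1` U).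
    by apply: cpi; exact: open_nbhs_nbhs.
  suff : cylinders (unpickle (pickle (mkseq (address t) k)))
    t by exists (pickle (mkseq (address t) k)).
  rewrite pickleK /cylinders ifT /= ?size_mkseq//.
  by apply/asboolP => w; rewrite ?size_mkseq; exact: hk.
rewrite /cylinders; case: (unpickle n) => [s|//]; case: ifP => // /asboolP h /= ts.
exact: h.
Qed.

End BinaryAddress.

Section BorelMeasurability.
Context {T U : ptopologicalType}.

Lemma measurable_open (A : set T) : open A -> measurable (A : set (borel T)).
Proof. exact: sub_sigma_algebra. Qed.

Lemma continuous_borel (f : T -> U) :
  continuous f -> measurable_fun setT (f : borel T -> borel U).
Proof.
move=> cf; apply: (@measurability _ _ _ (borel U) setT _ (@open U)) => //.
move=> _ [V oV <-]; rewrite setTI; apply: measurable_open.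
by move/continuousP : cf; exact.
Qed.

Lemma continuous_borel_real (R : realType) (f : T -> R) :
  continuous f -> measurable_fun setT (f : borel T -> R).
Proof.
move=> cf; apply: (measurability _ (RGenOInfty.measurableE R)) => _ [_ [a ->] <-].
rewrite setTI; apply: measurable_open.
by move/continuousP : cf; apply; exact: interval_open.
Qed.

End BorelMeasurability.

Section BoundedIntegrals.
Context {d} {T : measurableType d} {R : realType} (P : probability T R).

Lemma bounded_integrable (f : T -> R) (M : R) : measurable_fun setT f ->
  (forall x, `|f x| <= M) -> P.-integrable setT (EFin \o f).
Proof.
move=> mf fM; apply: measurable_bounded_integrable => //.
  by rewrite -ge0_fin_numE// fin_num_measure.
exists M; split; first exact: num_real.
by move=> K MK x _ /=; rewrite (le_trans (fM x))// ltW.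
Qed.

Lemma Rintegral_cst_prob (r : R) : \int[P]_x r = r.
Proof.
rewrite Rintegral_cst// (_ : Measure.sort _ _ = 1%E) ?mulr1//.
exact: (probability_setT P).
Qed.

Lemma Rintegral_dist (f g : T -> R) (M e : R) :
  measurable_fun setT f -> measurable_fun setT g ->
  (forall x, `|f x| <= M) -> (forall x, `|f x - g x| <= e) ->
  `|\int[P]_x f x - \int[P]_x g x| <= e.
Proof.
move=> mf mg fM fge.
have gM x : `|g x| <= M + e.
  by rewrite -[g x](subrK (f x)) (le_trans (ler_normD _ _))// addrC lerD// distrC.
have If := bounded_integrable mf fM; have Ig := bounded_integrable mg gM.
rewrite -RintegralB//.
have Ifg : P.-integrable setT (EFin \o (fun x => f x - g x)).
  by apply: bounded_integrable fge; exact: measurable_funB.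
apply: le_trans (le_normr_Rintegral _ Ifg) _ => //.
rewrite -[leRHS](Rintegral_cst_prob e); apply: le_Rintegral => //.
- apply: (bounded_integrable (f := fun x => `|f x - g x|) (M := e)).
    by apply: measurableT_comp => //; exact: measurable_funB.
  by move=> x; rewrite normr_id.
- by apply: (bounded_integrable (f := fun=> e) (M := `|e|)); first exact: measurable_cst.
Qed.

Lemma Rintegral_steps I (s : seq I) (a : I -> R) (A : I -> set T) :
  (forall i, measurable (A i)) ->
  \int[P]_x (\sum_(i <- s) a i * \1_(A i) x) = \sum_(i <- s) a i * fine (P (A i)).
Proof.
move=> mA.
have IA i : P.-integrable setT (EFin \o (fun x => a i * \1_(A i) x)).
  apply: (bounded_integrable (M := `|a i|)).
    by apply: measurable_funM => //; exact: measurable_indic.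
  by move=> x; rewrite normrM indicE; case: (_ \in _);
    rewrite ?normr1 ?normr0 ?mulr1 ?mulr0.
rewrite /Rintegral; under eq_integral do rewrite -sumEFin.
rewrite integral_sum// -sum_fine; last first.
  by move=> i _; exact: integrable_fin_num (IA i).
apply: eq_bigr => i _; under eq_integral do rewrite EFinM.
rewrite integralZl//; last exact: integrable_indic.
by rewrite integral_indic// setIT fineM// fin_num_measure.
Qed.

End BoundedIntegrals.

Section Empirical.
Context {R : realType} {T : ptopologicalType}.

Lemma ge0_integral_empirical (S : T -> T) (x : T) N (f : T -> R) :
  measurable_fun setT (f : borel T -> R) -> (forall y, 0 <= f y) ->
  (\int[@empirical R T S x N]_y (f y)%:E =
   (N%:R^-1 * \sum_(n < N) f (iter n S x))%:E)%E.
Proof.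
move=> mf f0; have mf' : measurable_fun [set: borel T] (EFin \o f).
  exact/measurable_EFinP.
rewrite ge0_integral_mscale//; last by move=> y _; rewrite lee_fin.
rewrite ge0_integral_measure_sum//; last by move=> y _; rewrite lee_fin.
rewrite EFinM -sumEFin; congr (_ * _)%E; apply: eq_bigr => n _.
by rewrite integral_dirac// diracT mul1e.
Qed.

Lemma Rintegral_empirical (S : T -> T) (x : T) N (f : T -> R) :
  measurable_fun setT (f : borel T -> R) ->
  \int[@empirical R T S x N]_y f y = N%:R^-1 * \sum_(n < N) f (iter n S x).
Proof.
move=> mf; rewrite /Rintegral integralE.
rewrite (eq_integral (fun y : borel T => (Num.max (f y) 0)%:E)); last first.
  by move=> y _; rewrite funeposE -EFin_max.
rewrite [X in (_ - X)%E](eq_integral (fun y : borel T => (Num.max (- f y)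
  0)%:E)); last first.
  by move=> y _; rewrite funenegE -EFinN -EFin_max.
rewrite (ge0_integral_empirical _ _ _ (f := fun y => Num.max (f y) 0)).
- rewrite (ge0_integral_empirical _ _ _ (f := fun y => Num.max (- f y) 0)).
  + rewrite -EFinB /= -mulrBr -sumrB; congr (_ * _); apply: eq_bigr => n _.
    by case: (leP (f (iter n S x)) 0) => h;
      [rewrite (max_l (x := - _)) ?oppr_ge0// | rewrite (max_r (x := - _))
        ?oppr_le0 ?ltW//]; lra.
  + by apply: measurable_maxr => //; exact: measurableT_comp.
  + by move=> y; rewrite le_max lexx orbT.
- exact: measurable_maxr.
- by move=> y; rewrite le_max lexx orbT.
Qed.

End Empirical.

Lemma cantor_bounded (R : realType) (g : cantor_space -> R) :
  continuous g -> exists M, forall w, `|g w| <= M.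
Proof.
move=> cg; have /compact_bounded[M [_ hM]] : compact (g @` setT).
  by apply: continuous_compact; [exact: continuous_subspaceT|exact: cantor_space_compact].
by exists (M + 1) => w; apply: (hM (M + 1)); [rewrite ltrDl|exists w].
Qed.

Section EmpiricalLimit.
Context {R : realType} {T : ptopologicalType}.
Variables (pi : cantor_space -> T) (S : T -> T) (x : T) (B : set nat).
Hypotheses (cpi : continuous pi) (pi_surj : forall y, exists w, pi w = y)
  (Binf : forall n, exists2 N : nat, (n < N)%N & B N).

(* Along a subsequence the frequencies of all binary cylinders converge, say to
   p; the limit measure is the image of the Lebesgue measure on [0, 1[ under the
   address map of p. *)
Lemma empirical_limit : exists nu : probability (borel T) R, exists N : nat -> nat,
  [/\ {homo N : i j / (i < j)%N}, forall k, B (N k) &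
      weakstar_cvg (fun k => empirical S x (N k)) nu].
Proof.
(* The codes of the orbit points are chosen independently of each other and need not form an orbit;
   only the frequencies of their prefixes matter. *)
have [c cP] := choice (fun n => pi_surj (iter n S x)).
pose freq N (s : seq bool) : R := N%:R^-1 * \sum_(n < N) (mkseq (c n) (size s) == s)%:R.
have freq_ge0 N s : 0 <= freq N s by rewrite mulr_ge0 ?invr_ge0// sumr_ge0.
have freq_le1 N s : freq N s <= 1.
  rewrite /freq; case: N => [|N]; first by rewrite invr0 mul0r.
  rewrite ler_pdivrMl// mulr1 -[X in _ <= X%:R]card_ord -sum1_card natr_sum.
  by apply: ler_sum => n _; case: (_ == _).
have freq_nil N : (0 < N)%N -> freq N [::] = 1.
  move=> N0; rewrite /freq; rewrite (eq_bigr (fun=> 1))//.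
  by rewrite sumr_const card_ord mulVf// pnatr_eq0 -lt0n.
have freq_rcons N s : freq N s = freq N (rcons s false) + freq N (rcons s true).
  rewrite /freq -mulrDr -big_split; congr (_ * _); apply: eq_bigr => n _.
  rewrite /= !size_rcons !mkseqS !eqseq_rcons.
  by case: (_ == s); case: (c n _); rewrite ?addr0 ?add0r.
have [p [N [Nm NB Np]]] := @pointwise_subsequence R (seq bool) freq B
  (fun N s => introT andP (conj (freq_ge0 N s) (freq_le1 N s))) Binf.
have N_ge k : (k <= N k)%N.
  by elim: k => // k IH; rewrite (leq_ltn_trans IH)// Nm.
have p_ge0 s : 0 <= p s.
  by apply: (cvgr_to_ge (Np s)); near=> k; exact: freq_ge0.
(* The frequency of the empty word is 0 for N = 0, hence the restriction to indices k with N k >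
   0. *)
have p_nil : p [::] = 1.
  apply: (cvg_unique _ (Np [::])) => //; apply: cvg_near_cst.
  by exists 1%N => // k /= k1; rewrite freq_nil// (leq_trans k1).
have p_rcons s : p s = p (rcons s false) + p (rcons s true).
  have h : freq (N k) s @[k --> \oo] --> p (rcons s false) + p (rcons s true).
    have -> : (fun k => freq (N k) s) =
        (fun k => freq (N k) (rcons s false) + freq (N k) (rcons s true)).
      by apply/funext => k; exact: freq_rcons.
    by apply: cvgD; exact: Np.
  by apply: cvg_unique (Np s) h.
pose X : measurableTypeR R -> borel T := pi \o address p.
have mX : measurable_fun setT X by exact: measurable_fun_address.
pose Xm : {mfun measurableTypeR R >-> borel T} := HB.pack X
  (isMeasurableFun.Build _ _ _ _ X mX).
exists (distribution (@unit_itv_prob R) Xm), N; split => // f cf.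
pose g := f \o pi.
have cg : continuous g by move=> w; apply: continuous_comp; [exact: cpi|exact: cf].
have [M gM] := cantor_bounded cg.
have fM y : `|f y| <= M by have [w <-] := pi_surj y; exact: gM.
have mf := continuous_borel_real cf.
set P := @unit_itv_prob R.
have -> : \int[distribution P Xm]_y f y = \int[P]_t g (address p t).
  rewrite /Rintegral integral_distribution//; first exact/measurable_EFinP.
  apply: (@bounded_integrable _ _ _ P (f \o X) M) => [|t].
    exact: measurableT_comp.
  exact: fM.
apply/cvgrPdist_le => e e0.
have e4 : 0 < e / 3 by rewrite divr_gt0.
have [l hl] := cantor_uniform cg e4.
(* A step function replaces g: its value on a cylinder of depth l is that of g at the word padded
   with [false]. The three errors of e / 3 are the replacement under the limit measure, the
   replacement in the orbit averages, and the convergence of finitely many frequencies. *)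
pose G (s : seq bool) := g (fun i => nth false s i).
have Gg w : `|g w - G (mkseq w l)| <= e / 3.
  rewrite distrC ltW// hl//; apply: (@eq_from_nth _ false); rewrite !size_mkseq// => i il.
  by rewrite !nth_mkseq.
pose cell (s : l.-tuple bool) := [set t | mkseq (address p t) (size s) = s].
have GE w : G (mkseq w l) = \sum_(s : l.-tuple bool) G s * (mkseq w (size s) == s)%:R.
  have sz : size (mkseq w l) == l by rewrite size_mkseq.
  rewrite (bigD1 (Tuple sz))//= size_mkseq eqxx mulr1 big1 ?addr0// => s sl.
  rewrite size_tuple; case: eqP => [ws|]; rewrite ?mulr0//.
  by move/eqP : sl => []; apply: val_inj.
have GI : (fun t => G (mkseq (address p t) l)) =
    (fun t => \sum_(s : l.-tuple bool) G s * \1_(cell s) t).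
  apply/funext => t; rewrite GE; apply: eq_bigr => s _; rewrite indicE.
  congr (_ * (nat_of_bool _)%:R).
  by apply/eqP/idP => [ts|/set_mem//]; apply/mem_set.
have intG : \int[P]_t G (mkseq (address p t) l) = \sum_(s : l.-tuple bool) G s * p s.
  rewrite GI.
  rewrite Rintegral_steps; last by move=> s; exact: measurable_address.
  apply: eq_bigr => s _; rewrite -[p s]/(fine (p s)%:E); congr (_ * fine _).
  exact: unit_itv_prob_address.
have h1 : `|\int[P]_t g (address p t) - \int[P]_t G (mkseq (address p t) l)| <= e / 3.
  apply: (@Rintegral_dist _ _ _ _ _ _ M) => //.
  - exact: (measurableT_comp mf mX).
  - rewrite GI.
    apply: (@measurable_sum _ _ _ setT _ _ (fun (s : l.-tuple bool)
      t => G s * \1_(cell s) t)) => s.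
    apply: measurable_funM; first exact: measurable_cst.
    by apply: measurable_indic; exact: measurable_address.
have h2 n : `|n%:R^-1 * \sum_(i < n) g (c i) - n%:R^-1 * \sum_(i < n)
  G (mkseq (c i) l)| <= e / 3.
  rewrite -mulrBr -sumrB normrM ger0_norm ?invr_ge0//.
  case: n => [|n]; first by rewrite invr0 mul0r ltW.
  rewrite ler_pdivrMl// (le_trans (ler_norm_sum _ _ _))//.
  apply: (@le_trans _ _ (\sum_(i < n.+1) e / 3)); first exact: ler_sum.
  by rewrite sumr_const card_ord mulr_natl.
have h3 n : n%:R^-1 * \sum_(i < n) G (mkseq (c i) l) = \sum_(s : l.-tuple bool)
  G s * freq n s.
  under eq_bigr do rewrite GE.
  rewrite exchange_big mulr_sumr; apply: eq_bigr => s _.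
  by rewrite -mulr_sumr mulrCA.
have h4 : \sum_(s : l.-tuple bool) G s * freq (N k) s @[k --> \oo] -->
    \sum_(s : l.-tuple bool) G s * p s.
  apply: cvg_big => [|s _]; first exact: add_continuous.
  by apply: cvgM; [exact: cvg_cst|exact: Np].
move/cvgrPdist_le : h4 => /(_ _ e4); apply: filterS => k /=.
rewrite -h3 -intG Rintegral_empirical// => h4.
have -> : \sum_(n < N k) f (iter n S x) = \sum_(n < N k) g (c n).
  by apply: eq_bigr => n _; rewrite /g /= cP.
move: h1 (h2 (N k)) h4.
set a := \int[P]_t _; set b := \int[P]_t _; set a' := (N k)%:R^-1 * _;
  set b' := (N k)%:R^-1 * _.
by rewrite !ler_norml => /andP[? ?] /andP[? ?] /andP[? ?]; apply/andP; split; lra.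
Unshelve. all: by end_near. Qed.

End EmpiricalLimit.

(** If infinitely many N violated the bound, an empirical limit along such N would belong to
    Q-gen(u) and have integral at least a + d. *)
Lemma Qgen_upper_average (R : realType) (L : {posnum R}) (u : biseq L)
    (f : biseq L -> R) (a d : R) :
  continuous f -> (forall nu, Qgen u nu -> \int[nu]_w f w <= a) -> 0 < d ->
  exists N0, forall N, (N0 <= N)%N ->
    N%:R^-1 * \sum_(n < N) f (iter n (@biseq_shift R L) u) <= a + d.
Proof.
move=> cf hf d0; apply: contrapT => hn.
pose B := [set N | a + d < N%:R^-1 * \sum_(n < N) f (iter n (@biseq_shift R L) u)].
have Binf n : exists2 N, (n < N)%N & B N.
  apply: contrapT => h; apply: hn; exists n.+1 => N nN.
  by rewrite leNgt; apply/negP => BN; apply: h; exists N.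
have [pi cpi pi_surj] := cantor_biseq L.
have [nu [N [Nm NB cvN]]] :=
  @empirical_limit R (biseq L) pi (@biseq_shift R L) u B cpi pi_surj Binf.
have Qnu : Qgen u nu by exists N.
have := hf nu Qnu; rewrite leNgt => /negP; apply.
apply: (@lt_le_trans _ _ (a + d)); first by rewrite ltrDl.
apply: (cvgr_to_ge (cvN f cf)); near=> k.
rewrite Rintegral_empirical; first exact: ltW (NB k).
exact: continuous_borel_real.
Unshelve. all: by end_near. Qed.

(** * Approximating bounded Borel functions by continuous ones *)

Section BoundedMeasurable.
Context {d} {T : measurableType d} {R : realType} (P : probability T R).

Definition bmeasurable (f : T -> R) :=
  measurable_fun setT f /\ exists M, forall x, `|f x| <= M.

Lemma bmeasurable_cst r : bmeasurable (fun=> r).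
Proof. by split; [exact: measurable_cst|exists `|r|]. Qed.

Lemma bmeasurableD f g : bmeasurable f -> bmeasurable g ->
  bmeasurable (fun x => f x + g x).
Proof.
move=> [mf [M fM]] [mg [N gN]]; split; first exact: measurable_funD.
by exists (M + N) => x; rewrite (le_trans (ler_normD _ _))// lerD.
Qed.

Lemma bmeasurableM f g : bmeasurable f -> bmeasurable g ->
  bmeasurable (fun x => f x * g x).
Proof.
move=> [mf [M fM]] [mg [N gN]]; split; first exact: measurable_funM.
by exists (M * N) => x; rewrite normrM ler_pM.
Qed.

Lemma bmeasurableB f g : bmeasurable f -> bmeasurable g ->
  bmeasurable (fun x => f x - g x).
Proof.
move=> [mf [M fM]] [mg [N gN]]; split; first exact: measurable_funB.
by exists (M + N) => x; rewrite (le_trans (ler_normB _ _))// lerD.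
Qed.

Lemma bmeasurable_norm f : bmeasurable f -> bmeasurable (fun x => `|f x|).
Proof.
move=> [mf [M fM]]; split; first exact: measurableT_comp.
by exists M => x; rewrite normr_id.
Qed.

Lemma bmeasurable_indic A : measurable A -> bmeasurable (\1_A : T -> R).
Proof.
move=> mA; split; first exact: measurable_indic.
by exists 1 => x; rewrite indicE; case: (_ \in _); rewrite ?normr1 ?normr0.
Qed.

Lemma bmeasurable_integrable f : bmeasurable f -> P.-integrable setT (EFin \o f).
Proof. by move=> [mf [M fM]]; exact: bounded_integrable fM. Qed.

Lemma le_Rintegral_bm f g : bmeasurable f -> bmeasurable g ->
  (forall x, f x <= g x) -> \int[P]_x f x <= \int[P]_x g x.
Proof.
by move=> bf bg fg; apply: le_Rintegral => //; exact: bmeasurable_integrable.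
Qed.

Lemma RintegralD_bm f g : bmeasurable f -> bmeasurable g ->
  \int[P]_x (f x + g x) = \int[P]_x f x + \int[P]_x g x.
Proof. by move=> bf bg; apply: RintegralD => //; exact: bmeasurable_integrable. Qed.

Lemma RintegralZ_bm r f : bmeasurable f ->
  \int[P]_x (r * f x) = r * \int[P]_x f x.
Proof. by move=> bf; apply: RintegralZl => //; exact: bmeasurable_integrable. Qed.

Lemma Rintegral_cvg0 (h : nat -> T -> R) (M : R) :
  (forall n, measurable_fun setT (h n)) -> (forall n x, `|h n x| <= M) ->
  (forall x, h n x @[n --> \oo] --> 0) ->
  \int[P]_x h n x @[n --> \oo] --> 0.
Proof.
move=> mh hM h0.
have : (\int[P]_x (h n x)%:E)%E @[n --> \oo] --> (\int[P]_x (cst 0%E x))%E.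
  apply: (@dominated_cvg _ _ _ _ _ measurableT _ _ (cst M%:E)) => //.
  - by move=> n; apply/measurable_EFinP.
  - by move=> x _; apply: cvg_EFin; [exact: nearW|exact: h0].
  - exact: (bmeasurable_integrable (bmeasurable_cst M)).
  - by move=> n x _; rewrite lee_fin.
by rewrite integral0 => /fine_cvgP[].
Qed.

End BoundedMeasurable.

Section InfContinuous.
Context {R : realType} {X : topologicalType} {I : Type} (i0 : I).
Variable F : I -> X -> R.
Hypothesis F_ge0 : forall i x, 0 <= F i x.
Hypothesis F_equicontinuous : forall x e, 0 < e ->
  \forall y \near x, forall i, `|F i x - F i y| <= e.

(** It serves twice: for the distance to the complement of an open set, and for [orbit_distance]. *)
Definition inf_fun x := inf [set F i x | i in setT].

Lemma inf_fun_le i x : inf_fun x <= F i x.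
Proof. by apply: ge_inf; [exists 0 => _ [j _ <-]|exists i]. Qed.

Lemma inf_fun_ge x a : (forall i, a <= F i x) -> a <= inf_fun x.
Proof. by move=> h; apply: lb_le_inf; [exists (F i0 x), i0|move=> _ [j _ <-]]. Qed.

Lemma inf_fun_lt x a : inf_fun x < a -> exists i, F i x < a.
Proof.
move=> h; apply: contrapT => /forallNP hn; move: h; apply/negP; rewrite -leNgt.
by apply: inf_fun_ge => i; rewrite leNgt; apply/negP.
Qed.

Lemma inf_fun_continuous : continuous inf_fun.
Proof.
move=> x; apply/cvgrPdist_le => e e0.
apply: filterS (F_equicontinuous x e0) => y h.
rewrite ler_distlC; apply/andP; split; rewrite -?lerBlDr; apply: inf_fun_ge => i;
  rewrite lerBlDr; have := h i; rewrite ler_distl => /andP[h1 h2].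
- by rewrite (le_trans (inf_fun_le i x)).
- by rewrite (le_trans (inf_fun_le i y))//; lra.
Qed.

End InfContinuous.

Section LOneDensity.
Context {R : realType} {X : pmetricType R} (mu : probability (borel X) R).

Definition approximable (h : X -> R) := forall e, 0 < e ->
  exists f : X -> R, [/\ continuous f, exists M, forall x, `|f x| <= M &
    \int[mu]_x `|h x - f x| <= e].

Lemma continuous_bmeasurable (f : X -> R) (M : R) : continuous f ->
  (forall x, `|f x| <= M) ->
  bmeasurable (f : borel X -> R).
Proof. by move=> cf fM; split; [exact: continuous_borel_real|exists M]. Qed.

Lemma approximable_cst r : approximable (fun=> r).
Proof.
move=> e e0; exists (fun=> r); split; [exact: cst_continuous|by exists `|r| |].
under eq_Rintegral do rewrite subrr normr0.
by rewrite Rintegral_cst_prob ltW.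
Qed.

Lemma approximable_lin (a : R) (g h : X -> R) :
  bmeasurable (g : borel X -> R) -> bmeasurable (h : borel X -> R) ->
  approximable g -> approximable h -> approximable (fun x => g x + a * h x).
Proof.
move=> bg bh ag ah e e0.
have a1 : 0 < `|a| + 1 by rewrite ltr_wpDl.
have e2 : 0 < e / 2 by rewrite divr_gt0.
have [f [cf [M fM] gf]] := ag (e / 2) e2.
have [k [ck [N kN] hk]] := ah (e / 2 / (`|a| + 1)) (divr_gt0 e2 a1).
exists (fun x => f x + a * k x); split.
- by move=> x; apply: cvgD; [exact: cf|apply: cvgM; [exact: cvg_cst|exact: ck]].
- exists (M + `|a| * N) => x; rewrite (le_trans (ler_normD _ _))// lerD// normrM.
  by rewrite ler_wpM2l.
have bf := continuous_bmeasurable cf fM; have bk := continuous_bmeasurable ck kN.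
have bgf := bmeasurable_norm (bmeasurableB bg bf).
have bhk := bmeasurable_norm (bmeasurableB bh bk).
apply: (@le_trans _ _ (\int[mu]_x (`|g x - f x| + `|a| * `|h x - k x|))).
  apply: le_Rintegral_bm.
  - apply: bmeasurable_norm; apply: bmeasurableB; apply: bmeasurableD => //;
      exact: (bmeasurableM (bmeasurable_cst a)).
  - by apply: bmeasurableD => //; exact: (bmeasurableM (bmeasurable_cst `|a|)).
  - move=> x; rewrite opprD addrACA -mulrBr -normrM; exact: ler_normD.
rewrite RintegralD_bm//; last exact: (bmeasurableM (bmeasurable_cst `|a|)).
rewrite RintegralZ_bm// [leRHS](splitr e) lerD//.
apply: (@le_trans _ _ ((`|a| + 1) * \int[mu]_x `|h x - k x|)).
  by rewrite ler_wpM2r ?lerDl// Rintegral_ge0.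
by rewrite mulrC -ler_pdivlMr.
Qed.

Lemma approximable_limit (h : X -> R) (hn : nat -> X -> R) (M : R) :
  (forall n, bmeasurable (hn n : borel X -> R)) ->
  bmeasurable (h : borel X -> R) -> (forall n x, `|h x - hn n x| <= M) ->
  (forall x, hn n x @[n --> \oo] --> h x) ->
  (forall n, approximable (hn n)) -> approximable h.
Proof.
move=> bhn bh hM hcv ahn e e0.
have h0 : \int[mu]_x `|h x - hn n x| @[n --> \oo] --> 0.
  apply: (@Rintegral_cvg0 _ _ _ mu (fun n x => `|h x - hn n x|) M) => [n|n x|x].
  - by have [] := bmeasurable_norm (bmeasurableB bh (bhn n)).
  - by rewrite normr_id.
  - rewrite -(normr0 R) -(subrr (h x)); apply: cvg_norm; apply: cvgB => //.
    exact: cvg_cst.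
have e2 : 0 < e / 2 by rewrite divr_gt0.
move/cvgrPdist_le : h0 => /(_ _ e2) [n _ /(_ n (leqnn n))].
rewrite sub0r normrN => /(le_trans (ler_norm _)) hn1.
have [f [cf [N fN] hf]] := ahn n (e / 2) e2.
exists f; split=> //; first by exists N.
have bf := continuous_bmeasurable cf fN.
have b1 := bmeasurable_norm (bmeasurableB bh (bhn n)).
have b2 := bmeasurable_norm (bmeasurableB (bhn n) bf).
apply: (@le_trans _ _ (\int[mu]_x (`|h x - hn n x| + `|hn n x - f x|))).
  apply: le_Rintegral_bm; first exact: bmeasurable_norm (bmeasurableB bh bf).
    exact: bmeasurableD.
  by move=> x; exact: ler_distD.
by rewrite RintegralD_bm// [leRHS](splitr e) lerD.
Qed.

(** With d the distance to the complement, cut off at 1, the continuous functions 1 - (1 - d)^n tend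
    pointwise to the indicator of U. *)
Lemma approximable_open (U : set X) : open U -> approximable (\1_U : X -> R).
Proof.
move=> oU.
(* Points y of U get the value 1, so that the infimum runs over a nonempty index set even when U is
   the whole space, and d stays at most 1 on U. *)
pose F (y x : X) : R := if `[< ~ U y >] then mdist x y else 1.
have F0 y x : 0 <= F y x by rewrite /F; case: ifP => // _; exact: mdist_ge0.
have Feq x e : 0 < e -> \forall y \near x, forall i, `|F i x - F i y| <= e.
  move=> e0; near=> y => i; rewrite /F; case: ifP => _; last by rewrite subrr normr0 ltW.
  have xy : mdist x y < e.
    by near: y; apply/nbhs_ballP; exists e => //= y; rewrite ballEmdist.
  have := metric_triangle x y i; have := metric_triangle y x i.
  rewrite (metric_sym y x) ler_norml => h1 h2; apply/andP; split; lra.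
pose d := inf_fun F.
have cd : continuous d := inf_fun_continuous point F0 Feq.
have dU x : U x -> 0 < d x.
  move=> Ux; have [e /= e0 eU] : nbhs_ball x U.
    by apply/nbhs_ballP; exact: open_nbhs_nbhs.
  apply: (@lt_le_trans _ _ (Num.min e 1)); first by rewrite lt_min e0 ltr01.
  apply: (inf_fun_ge point) => y; rewrite /F; case: ifP => [/asboolP Uy|_]; last first.
    by rewrite ge_min lexx orbT.
  rewrite ge_min; apply/orP; left; rewrite leNgt; apply/negP => xy.
  by apply: Uy; apply: eU; rewrite ballEmdist.
have dNU x : ~ U x -> d x = 0.
  move=> Ux; apply/eqP; rewrite eq_le (inf_fun_ge point) ?andbT//.
  apply: (le_trans (inf_fun_le F0 x x)).
  by rewrite /F ifT ?mdistxx//; apply/asboolP.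
have d0 x : 0 <= d x by exact: (inf_fun_ge point).
have d1 x : d x <= 1.
  have [/dNU ->//|/contrapT Ux] := pselect (~ U x).
  by apply: le_trans (inf_fun_le F0 x x) _; rewrite /F ifF//; apply/asboolPn => /(_ Ux).
have dn n x : 0 <= (1 - d x) ^+ n <= 1.
  by rewrite exprn_ge0 ?exprn_ile1// ?subr_ge0// lerBlDr lerDl.
have cdn n : continuous (fun x => 1 - (1 - d x) ^+ n).
  move=> x; apply: cvgB; first exact: cvg_cst.
  apply: (@continuous_comp _ _ _ (fun x => 1 - d x) (fun y => y ^+ n));
    last exact: exprn_continuous.
  by apply: cvgB; [exact: cvg_cst|exact: cd].
have dn1 n x : `|1 - (1 - d x) ^+ n| <= 1.
  have := dn n x; set y := (1 - d x) ^+ n => /andP[? ?].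
  by rewrite ger0_norm ?subr_ge0// lerBlDr lerDl.
apply: (@approximable_limit _ (fun n x => 1 - (1 - d x) ^+ n) 1).
- by move=> n; exact: continuous_bmeasurable (cdn n) (dn1 n).
- by apply: bmeasurable_indic; exact: measurable_open.
- move=> n x; rewrite indicE; case: (_ \in _); last by rewrite sub0r normrN.
  have := dn n x; set y := (1 - d x) ^+ n => /andP[? ?].
  by rewrite opprB addrCA subrr addr0 ger0_norm.
- move=> x; rewrite indicE; have [Ux|Ux] := pselect (U x); last first.
    rewrite memNset// dNU// subr0 [X in X @ _](_ : _ = fun=> 0); first exact: cvg_cst.
    by apply/funext => n; rewrite expr1n subrr.
  rewrite mem_set// -[X in _ --> X]subr0; apply: cvgB; first exact: cvg_cst.
  by apply: cvg_expr; rewrite ger0_norm ?subr_ge0// ltrBlDr ltrDl; exact: dU.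
- move=> n e e0; exists (fun x => 1 - (1 - d x) ^+ n); split => //; first by exists 1.
  under eq_Rintegral do rewrite subrr normr0.
  by rewrite Rintegral_cst_prob ltW.
Unshelve. all: by end_near. Qed.

Lemma trivIset_sum_indic (F : (set X)^nat) n x : trivIset setT F ->
  \sum_(k < n) \1_(F k) x = \1_(\big[setU/set0]_(k < n) F k) x :> R.
Proof.
move=> tF; elim: n => [|n IH]; first by rewrite !big_ord0 indic0.
rewrite !big_ord_recr /= IH !indicE.
have [xF|xF] := pselect (F n x); last first.
  by rewrite (memNset xF) addr0 in_setU (memNset xF) orbF.
rewrite in_setU (mem_set xF) orbT memNset ?add0r//.
rewrite -(bigcup_mkord n F) => -[k /= kn xk].
by have := tF k n I I (ex_intro _ x (conj xk xF)) => e; rewrite e ltnn in kn.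
Qed.

Lemma approximable_measurable (A : set (borel X)) : measurable A ->
  approximable (\1_A : X -> R).
Proof.
move: A; apply: (@dynkin_induction _ (borel X) (@open X)
  (fun A => approximable (\1_A : X -> R))).
- by [].
- exact: openI.
- by apply: approximable_open; exact: openT.
- by move=> U; exact: approximable_open.
- move=> A mA aA.
  have -> : \1_(~` A) = (fun x => 1 + (- 1) * \1_A x) :> (X -> R).
    by apply/funext => x; rewrite !indicE in_setC; case: (_ \in _);
      rewrite /= ?mulr1 ?mulr0 ?addr0 ?subrr.
  apply: approximable_lin => //; [exact: bmeasurable_cst|exact:
    bmeasurable_indic|exact: approximable_cst].
- move=> F mF tF aF.
  pose hn n (x : X) : R := \sum_(k < n) \1_(F k) x.
  have hnE n x : hn n x = \1_(\big[setU/set0]_(k < n) F k) x by exact: trivIset_sum_indic.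
  have bhn n : bmeasurable (hn n : borel X -> R).
    have -> : hn n = \1_(\big[setU/set0]_(k < n) F k) by apply/funext => x; exact: hnE.
    by apply: bmeasurable_indic; apply: bigsetU_measurable.
  apply: (@approximable_limit _ hn 1) => //.
  + by apply: bmeasurable_indic; exact: bigcupT_measurable.
  + move=> n x; rewrite hnE !indicE; case: (_ \in _); case: (_ \in _);
      by rewrite /= ?subrr ?subr0 ?sub0r ?normrN ?normr0 ?normr1.
  + move=> x; apply: cvg_near_cst; have [[k _ xk]|xF] := pselect ((\bigcup_k F k) x).
      exists k.+1 => // n /= kn; rewrite hnE !indicE mem_set; last first.
        by rewrite -(bigcup_mkord n F); exists k.
      by rewrite mem_set//; exists k.
    apply: nearW => n; rewrite hnE !indicE !memNset// -(bigcup_mkord n F).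
    by move=> [k _ xk]; apply: xF; exists k.
  + elim=> [|n IH].
      have -> : hn 0 = fun=> 0 by apply/funext => x; rewrite /hn big_ord0.
      exact: approximable_cst.
    have -> : hn n.+1 = (fun x => hn n x + 1 * \1_(F n) x).
      by apply/funext => x; rewrite /hn big_ord_recr /= mul1r.
    by apply: approximable_lin => //; exact: bmeasurable_indic.
Qed.

(* Subtracting M / 2 times the indicator of {h >= M / 2} halves the range. *)
Lemma uniform_approximable n (M : R) (h : X -> R) :
  measurable_fun setT (h : borel X -> R) -> (forall x, 0 <= h x <= M) ->
  exists g : X -> R, [/\ bmeasurable (g : borel X -> R), approximable g &
    forall x, `|h x - g x| <= M / 2 ^+ n].
Proof.
elim: n M h => [|n IH] M h mh hM.
  exists (fun=> 0); split; [exact: bmeasurable_cst|exact: approximable_cst|].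
  by move=> x; have /andP[h0 ?] := hM x; rewrite subr0 ger0_norm// expr0 divr1.
pose A := [set x : borel X | M / 2 <= h x].
have mA : measurable A.
  have := mh measurableT _ (measurable_itv `[M / 2, +oo[); rewrite setTI.
  by congr measurable; apply/seteqP; split => x /=; rewrite in_itv/= andbT.
pose h' x := h x - M / 2 * \1_A x.
have mh' : measurable_fun setT (h' : borel X -> R).
  apply: measurable_funB => //; apply: measurable_funM; first exact: measurable_cst.
  exact: measurable_indic.
have hM' x : 0 <= h' x <= M / 2.
  have := hM x; rewrite /h' indicE; have [xA|xA] := pselect (A x).
    by rewrite mem_set// mulr1; move: xA; rewrite /A /= => xA /andP[? ?];
      apply/andP; split; lra.
  rewrite memNset// mulr0 subr0; move: xA => /negP; rewrite -ltNge => xA /andP[-> _].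
  exact: ltW.
have [g [bg ag hg]] := IH _ h' mh' hM'.
exists (fun x => g x + M / 2 * \1_A x); split.
- apply: bmeasurableD => //; apply: (bmeasurableM (bmeasurable_cst _)).
  exact: bmeasurable_indic.
- by apply: approximable_lin => //; [exact: bmeasurable_indic|exact:
  approximable_measurable].
- move=> x; rewrite exprS invfM mulrA; apply: le_trans (hg x).
  by rewrite /h' opprD addrA addrAC.
Qed.

Lemma bounded_approximable (h : X -> R) (M : R) :
  measurable_fun setT (h : borel X -> R) ->
  (forall x, `|h x| <= M) -> approximable h.
Proof.
move=> mh hM; pose h1 x := h x + M.
have mh1 : measurable_fun setT (h1 : borel X -> R) by exact: measurable_funD.
have h1M x : 0 <= h1 x <= M + M.
  by have := hM x; rewrite /h1 ler_norml => /andP[? ?]; apply/andP; split; lra.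
have M0 : 0 <= M + M by have /andP[h10] := h1M point; exact: le_trans.
have [g gP] := choice (fun n => uniform_approximable n mh1 h1M).
have bh1 : bmeasurable (h1 : borel X -> R).
  by split=> //; exists (M + M) => x; have /andP[? ?] := h1M x; rewrite ger0_norm.
have geo : (M + M) / 2 ^+ n @[n --> \oo] --> 0.
  rewrite -[X in _ --> X](mulr0 (M + M)); apply: cvgM; first exact: cvg_cst.
  by under eq_fun do rewrite -exprVn; apply: cvg_expr;
    rewrite ger0_norm// invf_lt1// ltr1n.
have a1 : approximable h1.
  apply: (@approximable_limit _ g (M + M)) => //.
  - by move=> n; have [] := gP n.
  - move=> n x; have [_ _ /(_ x) /le_trans] := gP n; apply.
    by rewrite ler_pdivrMr ?exprn_gt0// ler_peMr// exprn_ege1// ler1n.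
  - move=> x; apply/subr_cvg0; apply: norm_cvg0.
    apply: (squeeze_cvgr _ (cvg_cst 0) geo); apply: nearW => n.
    by rewrite normr_ge0 distrC; have [_ _ /(_ x)] := gP n.
  - by move=> n; have [] := gP n.
have -> : h = (fun x => h1 x + (- M) * cst 1 x).
  by apply/funext => x; rewrite /h1 mulr1 addrK.
by apply: approximable_lin => //; [exact: bmeasurable_cst|exact: approximable_cst].
Qed.

End LOneDensity.

(** * Isomorphic systems *)

Lemma probability_setI_full d (T : measurableType d) (R : realType)
    (P : probability T R) (A B : set T) :
  measurable A -> measurable B -> P A = 1%E -> P (A `&` B) = P B.
Proof.
move=> mA mB PA1.
have PC : P (~` A) = 0%E by rewrite probability_setC// PA1 subee.
have -> : P B = (P (B `&` A) + P (B `&` ~` A))%E.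
  rewrite -measureU; last by rewrite setIACA setICr setI0.
  - by rewrite -setIUr setUCr setIT.
  - exact: measurableI.
  - by apply: measurableI => //; exact: measurableC.
rewrite [X in (_ + X)%E](_ : _ = 0%E) ?adde0; first by rewrite setIC.
apply/eqP; rewrite eq_le measure_ge0 andbT -PC le_measure// ?inE//.
  by apply: measurableI => //; exact: measurableC.
exact: measurableC.
Qed.

Lemma measure_isomorphic_sym (R : realType) d1 d2 (X : measurableType d1)
    (Y : measurableType d2) (mu : probability X R) (nu : probability Y R)
    (f : X -> X) (g : Y -> Y) :
  measure_isomorphic mu f nu g -> measure_isomorphic nu g mu f.
Proof.
move=> [X0 [Y0 [phi [psi [[mX0 X01 fX0] [mY0 Y01 gY0] [phiXY psiYX phiK psiK]
  [mphi mpsi] [push equi]]]]]].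
have XY x : X0 x -> Y0 (phi x) by move=> X0x; apply: phiXY; exists x.
have YX y : Y0 y -> X0 (psi y) by move=> Y0y; apply: psiYX; exists y.
exists Y0, X0, psi, phi; split => //; split.
  move=> A mA; rewrite -push; last exact: mpsi.
  rewrite -(probability_setI_full mX0 mA X01); congr (mu _).
  apply/seteqP; split => x [X0x] /=; first by move=> [_]; rewrite phiK// inE.
  by move=> Ax; split => //; split; [exact: XY|rewrite phiK// inE].
move=> y /set_mem Y0y; apply: esym.
have X0y : X0 (f (psi y)) by apply: fX0; exists (psi y) => //; exact: YX.
rewrite -[LHS]phiK; last exact: mem_set.
by rewrite equi ?psiK//; apply/mem_set => //; exact: YX.
Qed.

(** The domains shrink to the points whose image in Y lies in both [Y0] and [Y0']. They keep full
    measure because the intersection of two full sets is full, and they stay forward invariant by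
    equivariance. *)
Lemma measure_isomorphic_trans (R : realType) d1 d2 d3 (X : measurableType d1)
    (Y : measurableType d2) (Z : measurableType d3) (mu : probability X R)
    (nu : probability Y R) (rho : probability Z R) (f : X -> X) (g : Y ->
      Y) (h : Z -> Z) :
  measure_isomorphic mu f nu g -> measure_isomorphic nu g rho h ->
  measure_isomorphic mu f rho h.
Proof.
move=> [X0 [Y0 [phi [psi [[mX0 X01 fX0] [mY0 Y01 gY0] [phiXY psiYX phiK psiK]
  [mphi mpsi] [push equi]]]]]].
move=> [Y0' [Z0 [phi' [psi' [[mY0' Y0'1 gY0'] [mZ0 Z01 hZ0]
  [phiYZ psiZY phi'K psi'K] [mphi' mpsi'] [push' equi']]]]]].
have XY x : X0 x -> Y0 (phi x) by move=> X0x; apply: phiXY; exists x.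
have YX y : Y0 y -> X0 (psi y) by move=> Y0y; apply: psiYX; exists y.
have YZ x : Y0' x -> Z0 (phi' x) by move=> X0x; apply: phiYZ; exists x.
have ZY y : Z0 y -> Y0' (psi' y) by move=> Y0y; apply: psiZY; exists y.
have phiK' x : X0 x -> psi (phi x) = x by move=> /mem_set; exact: phiK.
have psiK' x : Y0 x -> phi (psi x) = x by move=> /mem_set; exact: psiK.
have phi'K' x : Y0' x -> psi' (phi' x) = x by move=> /mem_set; exact: phi'K.
have psi'K' x : Z0 x -> phi' (psi' x) = x by move=> /mem_set; exact: psi'K.
have equi'' x : X0 x -> phi (f x) = g (phi x) by move=> /mem_set; exact: equi.
have equi''' x : Y0' x -> phi' (g x) = h (phi' x) by move=> /mem_set; exact: equi'.
have mX1 : measurable (X0 `&` phi @^-1` Y0') by exact: mphi.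
have mZ1 : measurable (Z0 `&` psi' @^-1` Y0) by exact: mpsi'.
exists (X0 `&` phi @^-1` Y0'), (Z0 `&` psi' @^-1` Y0), (phi' \o phi), (psi \o psi').
split.
- split=> //; first by rewrite push.
  move=> _ [x [X0x Y0x] <-]; split; first by apply: fX0; exists x.
  by rewrite /= equi''//; apply: gY0'; exists (phi x).
- split=> //.
    rewrite -push' // (_ : _ `&` _ = Y0 `&` Y0').
      by rewrite (probability_setI_full mY0 mY0' Y01).
    apply/seteqP; split => y /=; first by move=> [yY' [_]]; rewrite phi'K'.
    by move=> [yY yY']; split => //; split; [exact: YZ|rewrite phi'K'].
  move=> _ [z [Z0z Y0z] <-]; split; first by apply: hZ0; exists z.
  have gY' : Y0' (g (psi' z)) by apply: gY0'; exists (psi' z) => //; exact: ZY.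
  rewrite /= -[z in h z]psi'K'// -equi'''; last exact: ZY.
  by rewrite phi'K'//; apply: gY0; exists (psi' z).
- split.
  + move=> _ [x [X0x Y0x] <-]; split; first exact: YZ.
    by rewrite /= phi'K'//; exact: XY.
  + move=> _ [z [Z0z Y0z] <-]; split; first exact: YX.
    by rewrite /= psiK'//; exact: ZY.
  + by move=> x /set_mem[X0x Y0x] /=; rewrite phi'K'// phiK'.
  + by move=> z /set_mem[Z0z Y0z] /=; rewrite psiK'// psi'K'.
- split.
  + apply: (measurable_comp mY0' _ mphi'); first by move=> _ [x [_ ?] <-].
    by apply: measurable_funS mphi => //; exact: subIsetl.
  + apply: (measurable_comp mY0 _ mpsi); first by move=> _ [x [_ ?] <-].
    by apply: measurable_funS mpsi' => //; exact: subIsetl.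
- split.
  + move=> B mB; rewrite -push'// -push; last exact: mphi'.
    by congr (mu _); apply/seteqP; split => x /=; tauto.
  + by move=> x /set_mem[X0x Y0x] /=; rewrite equi''// equi'''.
Qed.

Section Entries.
Context {R : realType} {L : {posnum R}}.
Implicit Types w : biseq L.

Lemma modulus_entry w n : modulus (entry w n) <= L%:num.
Proof. by have := set_valP (w n); rewrite /= modulusE lecR. Qed.

Lemma entry_iter_shift w n k : entry (iter n (@biseq_shift R L) w) k = entry w (k + n%:Z).
Proof.
elim: n k => [|n IH] k; first by rewrite addr0.
rewrite iterS {1}/entry /biseq_shift -/(entry _ (k + 1)) IH; congr entry.
by rewrite -addrA -[n.+1]add1n PoszD.
Qed.

Lemma continuous_shift : continuous (@biseq_shift R L).
Proof.
by apply: continuous_ptws => n; exact: (@proj_continuous int (fun=> disc L) (n + 1)).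
Qed.

Lemma continuous_entry n :
  continuous (fun w => complex.Re (entry w n)) /\
  continuous (fun w => complex.Im (entry w n)).
Proof.
have h w : entry y n @[y --> w] --> (entry w n : R[i]^o).
  apply: (@continuous_comp _ _ _ (fun w : biseq L => w n) set_val).
    exact: (@proj_continuous int (fun=> disc L) n).
  exact: continuous_set_val.
by split=> w; have /complex_cvgP[] := h w.
Qed.

Lemma biseq_bounded (f : biseq L -> R) : continuous f -> exists M, forall w, `|f w| <= M.
Proof.
move=> cf; have [pi cpi pi_surj] := cantor_biseq L.
have [M hM] : exists M, forall z, `|f (pi z)| <= M.
  by apply: cantor_bounded => z; apply: continuous_comp; [exact: cpi|exact: cf].
by exists M => w; have [z <-] := pi_surj w.
Qed.

End Entries.

Lemma Rintegral_measure_preserving (R : realType) d1 d2 (X : measurableType d1)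
    (Y : measurableType d2) (P : probability X R) (Q : probability Y R)
    (phi : X -> Y) (f : Y -> R) :
  measurable_fun setT phi -> (forall A, measurable A -> P (phi @^-1` A) = Q A) ->
  bmeasurable f -> \int[P]_x f (phi x) = \int[Q]_y f y.
Proof.
move=> mphi PQ bf; pose phim : {mfun X >-> Y} := HB.pack phi
  (isMeasurableFun.Build _ _ _ _ phi mphi).
rewrite /Rintegral.
have <- : (\int[distribution P phim]_y (f y)%:E = \int[Q]_y (f y)%:E)%E.
  by apply: eq_measure_integral => A mA _; exact: PQ.
rewrite integral_distribution//; first by apply/measurable_EFinP; case: bf.
apply: bmeasurable_integrable (f \o phi) _; case: bf => mf [M fM]; split.
  exact: measurableT_comp.
by exists M => x; exact: fM.
Qed.

Lemma Rintegral_sum_bm (R : realType) d (Y : measurableType d) (P : probability Y R)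
    I (s : seq I) (f : I -> Y -> R) : (forall i, bmeasurable (f i)) ->
  \int[P]_x (\sum_(i <- s) f i x) = \sum_(i <- s) \int[P]_x f i x.
Proof.
move=> bf; rewrite /Rintegral; under eq_integral do rewrite -sumEFin.
rewrite integral_sum//; last by move=> i; exact: bmeasurable_integrable (bf i).
by rewrite -sum_fine// => i _; exact: integrable_fin_num
  (bmeasurable_integrable P (bf i)).
Qed.

Lemma measurable_fun_extend d1 d2 (X : measurableType d1) (Y : measurableType d2)
    (D : set X) (f : X -> Y) (y : Y) : measurable D -> measurable_fun D f ->
  measurable_fun setT (fun x => if x \in D then f x else y).
Proof.
move=> mD mf _ B mB; rewrite setTI.
rewrite (_ : _ @^-1` B = (D `&` f @^-1` B) `|` (~` D `&` [set x | B y])).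
  apply: measurableU; first exact: mf.
  apply: measurableI; first exact: measurableC.
  have [By|By] := pselect (B y).
    by rewrite (_ : [set x | B y] = setT)//; apply/seteqP; split.
  by rewrite (_ : [set x | B y] = set0)//; apply/seteqP; split.
apply/seteqP; split => x /=; have [xD|xD] := pselect (D x).
- by rewrite mem_set//; left.
- by rewrite memNset//; right.
- by rewrite mem_set// => -[[]//|[]].
- by rewrite memNset// => -[[]//|[]].
Qed.

Lemma invariant_measure_iter (R : realType) d (Y : measurableType d) (f : Y -> Y)
    (P : probability Y R) h (B : set Y) :
  measurable_fun setT f -> invariant_measure f P -> measurable B ->
  P (iter h f @^-1` B) = P B.
Proof.
move=> mf inv; elim: h B => [//|h IH] B mB.
have mfB : measurable (f @^-1` B) by rewrite -[X in measurable X]setTI; exact: mf.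
by rewrite -(inv B mB) -(IH _ mfB).
Qed.

(** * Typical windows follow orbits of the model *)

Section OrbitApproximation.
Context {R : realType} {L : {posnum R}} {X : pmetricType R} (T : X -> X).

Definition deviation (fr fi : X -> R) (z : R[i]) (x : X) :=
  `|complex.Re z - fr x| + `|complex.Im z - fi x|.

(** The functions come before H: by invariance the terms of the window average all have the same
    integral, so the bound holds for every window length. [G] is kept general so that one infimum
    over several systems can be used for each of them. *)
Lemma orbit_approximation (nu : probability (borel (biseq L)) R)
    (mu : probability (borel X) R) e :
  invariant_measure (@biseq_shift R L : borel (biseq L) -> borel (biseq L)) nu ->
  measure_isomorphic nu (@biseq_shift R L : borel (biseq L) -> borel (biseq L))
     mu (T : borel X -> borel X) -> 0 < e ->
  exists fr fi : X -> R, [/\ continuous fr, continuous fi,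
    exists M, forall x, `|fr x| <= M /\ `|fi x| <= M &
    forall (H : nat) (G : biseq L -> R), continuous G ->
      (forall w x, G w <= H.+1%:R^-1 * \sum_(h < H.+1)
        deviation fr fi (entry w h%:Z) (iter h T x)) ->
      \int[nu]_w G w <= e].
Proof.
set S := @biseq_shift R L.
move=> inv [W0 [X0 [phi [psi [[mW0 W01 SW0] [mX0 X01 TX0]
  [phiWX psiXW phiK psiK] [mphi mpsi] [push equi]]]]]] e0.
have mS : measurable_fun setT (S : borel (biseq L) -> borel (biseq L)).
  by apply: continuous_borel; exact: continuous_shift.
(* The zeroth coordinate transported to the model, set to 0 off [X0], where [psi] is arbitrary. *)
pose coord (c : R[i] -> R) (x : X) : R := c (entry (psi x) 0) * \1_X0 x.
have coord_approx c : continuous (fun w : biseq L => c (entry w 0)) ->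
    (forall z, `|c z| <= modulus z) ->
    bmeasurable (coord c : borel X -> R) /\ approximable mu (coord c).
  move=> cc cm.
  have mc : measurable_fun setT (coord c : borel X -> R).
    have -> : coord c = (fun x => c (entry (if x \in X0 then psi x else point)
      0) * \1_X0 x).
      by apply/funext => x; rewrite /coord indicE; case: (x \in X0); rewrite ?mulr0.
    apply: measurable_funM; last exact: measurable_indic.
    apply: (measurableT_comp (f := fun w : borel (biseq L) => c (entry w 0))).
      exact: continuous_borel_real.
    exact: measurable_fun_extend.
  have cL x : `|coord c x| <= L%:num.
    rewrite /coord normrM indicE; case: (_ \in _);
      rewrite /= ?normr1 ?normr0 ?mulr1 ?mulr0//.
    exact: le_trans (cm _) (modulus_entry _ _).
  split; first by split => //; exists L%:num.
  exact: bounded_approximable mc cL.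
have e2 : 0 < e / 2 by rewrite divr_gt0.
have [cr ci] := @continuous_entry R L 0.
have [br /(_ _ e2)[fr [cfr [Mr frM] ir]]] := coord_approx _ cr (@Re_le_modulus R).
have [bi /(_ _ e2)[fi [cfi [Mi fiM] ii]]] := coord_approx _ ci (@Im_le_modulus R).
have bfr := continuous_bmeasurable cfr frM.
have bfi := continuous_bmeasurable cfi fiM.
exists fr, fi; split => //.
  exists (Num.max Mr Mi) => x; split; rewrite le_max ?frM ?fiM ?orbT//.
move=> H G cG GH; have [M GM] := biseq_bounded cG.
pose E x := `|coord (@complex.Re R) x - fr x| + `|coord (@complex.Im R) x - fi x|.
have bE : bmeasurable (E : borel X -> R).
  by apply: bmeasurableD; apply: bmeasurable_norm; apply: bmeasurableB.
have intE : \int[mu]_x E x <= e.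
  rewrite [leRHS]splitr RintegralD_bm; last 2 first.
    exact: bmeasurable_norm (bmeasurableB br bfr).
    exact: bmeasurable_norm (bmeasurableB bi bfi).
  exact: lerD.
pose Phi (w : borel (biseq L)) : borel X := if w \in W0 then phi w else point.
have mPhi : measurable_fun setT Phi by exact: measurable_fun_extend.
have pushPhi A : measurable A -> nu (Phi @^-1` A) = mu A.
  move=> mA; have mB : measurable (Phi @^-1` A)
    by rewrite -[X in measurable X]setTI; exact: mPhi.
  rewrite -push// -(probability_setI_full mW0 mB W01); congr (nu _).
  by apply/seteqP; split => w /= [W0w]; rewrite /Phi mem_set.
have SW h w : W0 w -> W0 (iter h S w).
  by move=> W0w; elim: h => // h IH; rewrite iterS; apply: SW0; exists (iter h S w).
have phiS h w : W0 w -> phi (iter h S w) = iter h T (phi w).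
  move=> W0w; elim: h => //= h IH; rewrite equi ?IH//.
  by apply/mem_set; exact: SW.
have miter h : measurable_fun setT (fun w : borel (biseq L)
  => iter h S w : borel (biseq L)).
  elim: h => [|h IH]; first exact: measurable_id.
  exact: (measurableT_comp mS IH).
have mPhih h : measurable_fun setT (fun w : borel (biseq L) => Phi (iter h S w)).
  exact: (measurableT_comp mPhi (miter h)).
have pres h A : measurable A -> nu ((fun w => Phi (iter h S w)) @^-1` A) = mu A.
  move=> mA; have mB : measurable (Phi @^-1` A).
    by rewrite -[X in measurable X]setTI; exact: mPhi.
  rewrite -pushPhi// -(invariant_measure_iter h mS inv mB).
  by [].
have [mE [N EN]] := bE.
have bEh h : bmeasurable (fun w : borel (biseq L) => E (Phi (iter h S w))).
  split; first exact: (measurableT_comp mE (mPhih h)).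
  by exists N => w; exact: EN.
(* On [W0] the point x = phi w is used; the complement is a null set, where the bound M of [G] is
   enough. *)
have key w : G w <= H.+1%:R^-1 * \sum_(h < H.+1) E (Phi (iter h S w)) + M * \1_(~` W0) w.
  rewrite indicE; have [W0w|W0w] := pselect (W0 w); last first.
    rewrite mem_set// mulr1 ler_wpDl//; last exact: le_trans (ler_norm _) (GM w).
    by rewrite mulr_ge0 ?invr_ge0// sumr_ge0// => h _; rewrite addr_ge0.
  rewrite memNset ?mulr0 ?addr0//.
  apply: le_trans (GH w (phi w)) _; rewrite ler_wpM2l ?invr_ge0//.
  apply: ler_sum => h _; rewrite le_eqVlt; apply/orP; left; apply/eqP.
  have W0h := SW h w W0w.
  rewrite /deviation /E /Phi mem_set// /coord indicE mem_set;
    last by apply: phiWX; exists (iter h S w).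
  by rewrite !mulr1 phiK ?mem_set// phiS// entry_iter_shift add0r.
have bS : bmeasurable (fun w : borel (biseq L) => \sum_(h < H.+1) E (Phi (iter h S w))).
  split; first by apply: measurable_sum => h; have [] := bEh h.
  exists (\sum_(h < H.+1) N) => w; rewrite (le_trans (ler_norm_sum _ _ _))//.
  by apply: ler_sum.
have bW : bmeasurable (\1_(~` W0) : borel (biseq L) -> R).
  by apply: bmeasurable_indic; exact: measurableC.
have bG : bmeasurable (G : borel (biseq L) -> R).
  by split; [exact: continuous_borel_real|exists M].
apply: (le_trans (le_Rintegral_bm nu bG _ key)).
  by apply: bmeasurableD; apply: bmeasurableM => //; exact: bmeasurable_cst.
rewrite RintegralD_bm ?RintegralZ_bm//; last 2 first.
  by apply: bmeasurableM => //; exact: bmeasurable_cst.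
  by apply: bmeasurableM => //; exact: bmeasurable_cst.
rewrite Rintegral_sum_bm//.
rewrite (eq_bigr (fun=> \int[mu]_x E x)); last first.
  by move=> h _; exact: (Rintegral_measure_preserving (mPhih h) (pres h) bE).
rewrite sumr_const card_ord -[X in _ * X + _]mulr_natl mulKf ?pnatr_eq0//.
rewrite [X in M * X](_ : _ = 0) ?mulr0 ?addr0//.
rewrite /Rintegral integral_indic//; last exact: measurableC.
have W0C : nu (~` W0) = 0%E by rewrite probability_setC// W01 subee.
by rewrite setIT (_ : Measure.sort _ _ = 0%E).
Qed.

End OrbitApproximation.

(** * Window averages *)

Section WindowAverages.
Context {R : realType}.

Lemma modulus_nat n : modulus (n%:R : R[i]) = n%:R.
Proof. by rewrite /modulus normr_nat -(rmorph_nat (real_complex R)). Qed.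

Lemma shifted_sum_dist (a : nat -> R[i]) (B : R) N h :
  (forall n, modulus (a n) <= B) ->
  modulus (\sum_(n < N) a (n + h)%N - \sum_(n < N) a n) <= 2 * B * h%:R.
Proof.
move=> aB; elim: h => [|h IH].
  by under eq_bigr do rewrite addn0; rewrite subrr modulus0 mulr0.
have -> : \sum_(n < N) a (n + h.+1)%N - \sum_(n < N) a n =
    (\sum_(n < N) a (n + h)%N - \sum_(n < N) a n) + (a (N + h)%N - a h).
  have e : \sum_(n < N) a (n + h.+1)%N = \sum_(n < N) a (n + h)%N + a (N + h)%N - a h.
    rewrite -(big_ord_recr _ (fun n => a (n + h)%N))
      [in RHS]big_ord_recl /= add0n addrAC subrr add0r.
    by apply: eq_bigr => n _; rewrite addSnnS.
  by rewrite e; ring.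
rewrite -[h.+1%:R]natr1 mulrDr mulr1 (le_trans (modulusD _ _))// lerD//.
by rewrite (le_trans (modulusD _ _))// modulusN mulr_natl mulr2n lerD.
Qed.

(** Each term is counted H + 1 times, once per position in a window. Passing from shift 1 to shift h
    through the unshifted sum costs 2B (1 + h), at most 2B (H + 1). *)
Lemma modulus_window_average (a : nat -> R[i]) (B : R) N H :
  (forall n, modulus (a n) <= B) ->
  H.+1%:R * modulus (\sum_(1 <= n < N.+1) a n) <=
  \sum_(n < N) modulus (\sum_(h < H.+1) a (n + h)%N) + 2 * B * H.+1%:R * H.+1%:R.
Proof.
move=> aB.
rewrite big_add1 /= big_mkord.
have -> : H.+1%:R * modulus (\sum_(n < N) a n.+1) = modulus (\sum_(h < H.+1)
  \sum_(n < N) a n.+1).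
  rewrite sumr_const card_ord -[in RHS](mulr_natl (\sum_(n < N) a n.+1)) modulusM.
  by rewrite modulus_nat.
have -> : \sum_(h < H.+1) \sum_(n < N) a n.+1 =
   \sum_(n < N) \sum_(h < H.+1) a (n + h)%N +
   \sum_(h < H.+1) (\sum_(n < N) a n.+1 - \sum_(n < N) a (n + h)%N).
  by rewrite [X in _ = X + _]exchange_big sumrB /= addrC subrK.
apply: le_trans (modulusD _ _) _; apply: lerD; first exact: modulus_sum.
apply: le_trans (modulus_sum _ _ _) _.
apply: (@le_trans _ _ (\sum_(h < H.+1) 2 * B * H.+1%:R)); last first.
  by rewrite sumr_const card_ord (mulr_natr (2 * B * H.+1%:R)).
apply: ler_sum => h _.
have h1 := shifted_sum_dist N 1 aB; have h2 := shifted_sum_dist N h aB.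
have -> : \sum_(n < N) a n.+1 - \sum_(n < N) a (n + h)%N =
  (\sum_(n < N) a (n + 1)%N - \sum_(n < N) a n) - (\sum_(n < N)
    a (n + h)%N - \sum_(n < N) a n).
  rewrite opprB addrA subrK; congr (_ - _).
  by apply: eq_bigr => n _; rewrite addn1.
apply: le_trans (modulusD _ _) _; rewrite modulusN.
apply: le_trans (lerD h1 h2) _; rewrite -mulrDr -natrD add1n ler_wpM2l ?ler_nat//.
by rewrite mulr_ge0// (le_trans (modulus_ge0 _) (aB 0)).
Qed.

End WindowAverages.

Lemma Rintegral_conv_hull (R : realType) d (T : measurableType d) m
    (kappa : 'I_m -> probability T R) (nu : probability T R) (f : T -> R) (a : R) :
  conv_hull kappa nu -> measurable_fun setT f -> (forall x, 0 <= f x) ->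
    (exists M, forall x, `|f x| <= M) ->
  (forall j, \int[kappa j]_x f x <= a) -> \int[nu]_x f x <= a.
Proof.
move=> [c [c0 c1 nuE]] mf f0 fM fa.
have bf : bmeasurable f by split.
pose k j : {measure set T -> \bar R} := mscale (NngNum (c0 j)) (kappa j).
(* [msum] is indexed by natural numbers, so the family is continued by the zero measure. *)
pose km n : {measure set T -> \bar R} := oapp k mzero (insub n).
have kmE (j : 'I_m) : km j = k j by rewrite /km insubT//= => lt_jm; congr k;
  apply: val_inj.
have -> : \int[nu]_x f x = \sum_j c j * \int[kappa j]_x f x.
  rewrite /Rintegral (@eq_measure_integral _ _ _ _ (msum km m)); last first.
    move=> A mA _; apply: (etrans (nuE A mA)); rewrite /msum /=.
    by apply: eq_bigr => j _; rewrite kmE.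
  rewrite ge0_integral_measure_sum//; last 2 first.
    by move=> x _; rewrite lee_fin.
    exact/measurable_EFinP.
  rewrite -sum_fine; last first.
    move=> j _; rewrite kmE ge0_integral_mscale//.
    - by rewrite fin_numM// (integrable_fin_num _ (bmeasurable_integrable (kappa j) bf)).
    - exact/measurable_EFinP.
    - by move=> x _; rewrite lee_fin.
  apply: eq_bigr => j _; rewrite kmE ge0_integral_mscale//; last 2 first.
    exact/measurable_EFinP.
    by move=> x _; rewrite lee_fin.
  by rewrite fineM// (integrable_fin_num _ (bmeasurable_integrable (kappa j) bf)).
rewrite -[leRHS]mul1r -c1 mulr_suml; apply: ler_sum => j _.
by rewrite ler_wpM2l.
Qed.

Lemma modulus_real_complex (R : realType) (r : R) : modulus ((r%:C)%C) = `|r|.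
Proof. by rewrite /modulus normc_def /= expr0n addr0 sqrtr_sqr. Qed.

Section StrongMOMO.
Context {R : realType} {L : {posnum R}} {X : topologicalType} (T : X -> X) (v : biseq L).
Context {m : nat} (f : 'I_m -> X -> R[i]^o) (M : R).
Hypotheses (f_continuous : forall j, continuous (f j))
  (f_bounded : forall j x, modulus (f j x) <= M).

(** MOMO concerns one function at a time, but the j selected for a window varies with n; the sum
    over all j dominates the selected term. *)
Definition block_sum n l x : R :=
  \sum_j modulus (\sum_(h < l) f j (iter h T x) * entry v (n + h)%N%:Z).

Lemma strong_MOMO_block_sums d : strong_MOMO T v -> 0 < d ->
  exists H, exists N0, forall N (x : nat -> X), (N0 <= N)%N ->
    \sum_(n < N) block_sum n H.+1 (x n) <= d * N%:R * H.+1%:R.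
Proof.
move=> momo; apply: (@block_sums_negligible _ _ _ (M * L%:num *+ m)).
- by move=> n l x; apply: sumr_ge0 => j _; exact: modulus_ge0.
- move=> n l x; rewrite [leRHS](_ : _ = \sum_(j < m) \sum_(h < l) M * L%:num); last first.
    by rewrite !sumr_const !card_ord mulr_natr mulrnAC.
  apply: ler_sum => j _; apply: le_trans (modulus_sum _ _ _) _; apply: ler_sum => h _.
  by rewrite modulusM ler_pM ?modulus_ge0// modulus_entry.
- move=> b x b0 bm bg.
  pose B j K := (b K)%:R^-1 * \sum_(k < K)
    modulus (\sum_(h < b k.+1 - b k) f j (iter h T (x k)) * entry v (b k + h)%N%:Z).
  have -> : (fun K => (b K)%:R^-1 * \sum_(k < K) block_sum (b k) (b k.+1 - b k) (x k)) =
      (fun K => \sum_j B j K).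
    by apply/funext => K; rewrite /B -mulr_sumr exchange_big.
  suff : \sum_(j < m) B j K @[K --> \oo] --> \sum_(j < m) (0 : R) by rewrite big1_eq.
  apply: cvg_big => [|j _]; first exact: add_continuous.
  pose z k := \sum_(b k <= n < b k.+1) f j (iter (n - b k) T (x k)) * entry v n%:Z.
  have zE k : z k = \sum_(h < b k.+1 - b k) f j (iter h T (x k)) * entry v (b k + h)%N%:Z.
    rewrite /z -{1}(add0n (b k)) big_addn big_mkord; apply: eq_bigr => h _.
    by rewrite addnK addnC.
  suff -> : B j = (fun K => modulus ((b K)%:R^-1 * \sum_(k < K) `|z k|)).
    by apply/complex_cvg0P; exact: momo b x (f j) b0 bm bg (@f_continuous j).
  apply/funext => K; rewrite (_ : _ * _ = ((B j K)%:C)%C).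
    by rewrite modulus_real_complex ger0_norm// mulr_ge0 ?invr_ge0// sumr_ge0//
      => k _; exact: modulus_ge0.
  rewrite rmorphM fmorphV rmorph_nat rmorph_sum; congr (_ * _); apply: eq_bigr => k _.
  by rewrite modulusE zE.
Qed.

End StrongMOMO.

(** MOMO sums contain v, the correlation its conjugate. Conjugating the whole sum moves the bar to
    the function on X, whence [-i*]. *)
Lemma window_modulus_le (R : realType) (L : {posnum R}) (X : pmetricType R) (T : X -> X)
    (u v : biseq L) (fr fi : X -> R) n H (x : X) :
  modulus (\sum_(h < H) entry u (n + h)%N%:Z * (entry v (n + h)%N%:Z)^*) <=
  L%:num * \sum_(h < H) deviation fr fi (entry (iter n (@biseq_shift R L) u)
    h%:Z) (iter h T x) +
  modulus (\sum_(h < H) (fr (iter h T x) -i* fi (iter h T x))%C * entry v (n + h)%N%:Z).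
Proof.
pose F h : R[i] := (fr (iter h T x) +i* fi (iter h T x))%C.
have -> : \sum_(h < H) entry u (n + h)%N%:Z * (entry v (n + h)%N%:Z)^* =
  \sum_(h < H) (entry u (n + h)%N%:Z - F h) * (entry v (n + h)%N%:Z)^* +
  \sum_(h < H) F h * (entry v (n + h)%N%:Z)^*.
  by rewrite -big_split; apply: eq_bigr => h _; rewrite /= -mulrDl subrK.
apply: le_trans (modulusD _ _) _; apply: lerD; last first.
  rewrite -[leRHS]modulusJ le_eqVlt; apply/orP; left; apply/eqP; congr modulus.
  rewrite rmorph_sum; apply: eq_bigr => h _; rewrite rmorphM /=; congr (_ * _).
  by rewrite /F -[RHS]/(conjc _) /= opprK.
rewrite mulr_sumr; apply: le_trans (modulus_sum _ _ _) _; apply: ler_sum => h _.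
rewrite modulusM modulusJ mulrC ler_pM ?modulus_ge0 ?modulus_entry//.
apply: le_trans (modulus_le_ReIm _) _.
rewrite entry_iter_shift /deviation /F -PoszD [(h + n)%N]addnC.
by case: (entry u _).
Qed.

Section OrbitDistance.
Context {R : realType} {L : {posnum R}} {X : pmetricType R} (T : X -> X).
Context {m : nat} (fr fi : 'I_m -> X -> R) (M : R).
Hypotheses (frM : forall j x, `|fr j x| <= M) (fiM : forall j x, `|fi j x| <= M).
Variables (H : nat) (j0 : 'I_m).

Definition window_deviation (i : 'I_m * X) (w : biseq L) : R :=
  H.+1%:R^-1 * \sum_(h < H.+1)
     deviation (fr i.1) (fi i.1) (entry w h%:Z) (iter h T i.2).

Definition orbit_distance : biseq L -> R := inf_fun window_deviation.

Lemma window_deviation_ge0 i w : 0 <= window_deviation i w.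
Proof. by rewrite mulr_ge0 ?invr_ge0// sumr_ge0// => h _; rewrite addr_ge0. Qed.

Lemma orbit_distance_ge0 w : 0 <= orbit_distance w.
Proof. by apply: (inf_fun_ge (j0, point)) => i; exact: window_deviation_ge0. Qed.

(** The pair (j, x) only fixes the segment to compare with. Moving w changes every deviation by at
    most the change of its entries 0, .., H, uniformly in the pair. *)
Lemma orbit_distance_continuous : continuous orbit_distance.
Proof.
apply: (inf_fun_continuous (j0, point)); first exact: window_deviation_ge0.
move=> w e e0; have e2 : 0 < e / 2 by rewrite divr_gt0.
have Fw : Filter (nbhs w) by exact: nbhs_filter.
have : \forall y \near w, forall h : 'I_H.+1,
    `|complex.Re (entry w h%:Z) - complex.Re (entry y h%:Z)| <= e / 2 /\
    `|complex.Im (entry w h%:Z) - complex.Im (entry y h%:Z)| <= e / 2.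
  apply: (filter_forall Fw) => h; have [cr ci] := @continuous_entry R L h%:Z.
  apply: filterI.
    by move/cvgrPdist_le : (cr w); apply.
  by move/cvgrPdist_le : (ci w); apply.
apply: filterS => y hy i.
rewrite /window_deviation -mulrBr -sumrB normrM ger0_norm ?invr_ge0// ler_pdivrMl//.
apply: le_trans (ler_norm_sum _ _ _) _.
rewrite [leRHS](_ : _ = \sum_(h < H.+1) e); last by rewrite sumr_const card_ord mulr_natl.
apply: ler_sum => h _; have [hr hi] := hy h.
rewrite /deviation opprD addrACA [leRHS]splitr.
apply: le_trans (ler_normD _ _) _; apply: lerD; apply: le_trans (ler_dist_dist _ _) _.
  by rewrite opprB addrA subrK.
by rewrite opprB addrA subrK.
Qed.

Lemma orbit_choice (w : biseq L) d : 0 < d ->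
  exists i, window_deviation i w < orbit_distance w + d.
Proof.
by move=> d0; apply: (inf_fun_lt (j0, point)); rewrite ltrDl.
Qed.

End OrbitDistance.

Theorem corollary12 (R : realType) (L : {posnum R})
    (kappa : probability (borel (biseq L)) R)
    (X : pmetricType R) (T : X -> X)
    (m : nat) (kappas : 'I_m -> probability (borel (biseq L)) R)
    (u v : biseq L) :
  let S := @biseq_shift R L : borel (biseq L) -> borel (biseq L) in
  ergodic S kappa ->
  uniquely_ergodic_model T kappa S ->
  (0 < m)%N ->
  (forall j, invariant_measure S (kappas j)) ->
  (forall j, measure_isomorphic (kappas j) S kappa S) ->
  Qgen u `<=` conv_hull kappas ->
  ~ ((N%:R^-1 * \sum_(1 <= n < N.+1) entry u n%:Z * (entry v n%:Z)^*
       : R[i]^o) @[N --> \oo] --> (0 : R[i]^o)) ->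
  ~ strong_MOMO T v.
Proof.
move=> S _ [_ _ [mu [_ _ iso_mu]]] m0 inv iso hQ hcorr momo; apply: hcorr.
have iso_kmu j := measure_isomorphic_trans (iso j) (measure_isomorphic_sym iso_mu).
apply/complex_cvg0P; apply/cvgrPdist_le => e e0.
have L0 : 0 < L%:num by [].
(* Three errors d arise: the integral of [G], the excess of its averages along u, and the inexact
   choice of a segment. Multiplied by L they add up to e / 3; MOMO and the boundary terms take the
   other two thirds. *)
pose d := e / (9 * L%:num).
have d0 : 0 < d by rewrite divr_gt0// mulr_gt0.
have happ j : exists p : (X -> R) * (X -> R) * R,
    [/\ continuous p.1.1, continuous p.1.2,
    forall x, `|p.1.1 x| <= p.2 /\ `|p.1.2 x| <= p.2 &
    forall (H : nat) (G : biseq L -> R), continuous G ->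
      (forall w x, G w <= H.+1%:R^-1 *
        \sum_(h < H.+1) deviation p.1.1 p.1.2 (entry w h%:Z) (iter h T x)) ->
      \int[kappas j]_w G w <= d].
  have [fr [fi [cfr cfi [M hM] hG]]] := orbit_approximation (inv j) (iso_kmu j) d0.
  by exists (fr, fi, M).
have [p pP] := choice happ.
pose fr j := (p j).1.1; pose fi j := (p j).1.2.
pose M := \sum_j `|(p j).2|.
have pM j : (p j).2 <= M.
  by rewrite /M (bigD1 j)//= (le_trans (ler_norm _))// lerDl sumr_ge0.
pose fc j : X -> R[i]^o := fun x => (fr j x -i* fi j x)%C.
have cfc j : continuous (fc j).
  have [cr ci _ _] := pP j.
  by move=> x; apply/complex_cvgP; split; [exact: cr|apply: cvgN; exact: ci].
have fcM j x : modulus (fc j x) <= M + M.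
  have [_ _ /(_ x)[h1 h2] _] := pP j.
  apply: le_trans (modulus_le_ReIm _) _; rewrite /fc /= normrN.
  by apply: lerD; [exact: le_trans h1 (pM j)|exact: le_trans h2 (pM j)].
have e3 : 0 < e / 3 by rewrite divr_gt0.
have [H [N0 hN0]] := strong_MOMO_block_sums cfc fcM momo e3.
pose j0 := Ordinal m0.
pose G : biseq L -> R := orbit_distance T fr fi H.
have cG : continuous G by exact: orbit_distance_continuous j0.
have G0 w : 0 <= G w by exact: orbit_distance_ge0 j0 w.
have intG nu : Qgen u nu -> \int[nu]_w G w <= d.
  move=> /hQ hnu; apply: (Rintegral_conv_hull hnu) => //.
  - exact: continuous_borel_real.
  - exact: biseq_bounded.
  - move=> j; have [_ _ _ hj] := pP j; apply: (hj H G cG) => w x.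
    exact: (inf_fun_le (window_deviation_ge0 T fr fi H) (j, x) w).
have [N1 hN1] := Qgen_upper_average cG intG d0.
(* The infimum need not be attained, so a pair within d of it is chosen, independently for each
   n. *)
have [ix ixP] := choice (fun n => orbit_choice T fr fi H j0 (iter n S u) d0).
pose a n : R[i] := entry u n%:Z * (entry v n%:Z)^*.
have aL n : modulus (a n) <= L%:num * L%:num.
  by rewrite modulusM modulusJ ler_pM ?modulus_ge0 ?modulus_entry.
have window n : modulus (\sum_(h < H.+1) a (n + h)%N) <=
    L%:num * H.+1%:R * (G (iter n S u) + d) + block_sum T v fc n H.+1 (ix n).2.
  apply: le_trans (window_modulus_le T u v (fr (ix n).1) (fi (ix n).1) n H.+1 (ix n).2) _.
  apply: lerD; last first.
    by rewrite /block_sum (bigD1 (ix n).1)//= lerDl sumr_ge0// => j _; exact: modulus_ge0.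
  rewrite -mulrA ler_wpM2l// -ler_pdivrMl// ltW//.
  exact: ixP.
near=> N.
have N_gt0 : 0 < N%:R :> R by rewrite ltr0n; near: N; exact: nbhs_infty_gt.
have NN0 : (N0 <= N)%N by near: N; exact: nbhs_infty_ge.
have NN1 : (N1 <= N)%N by near: N; exact: nbhs_infty_ge.
(* This makes the boundary error 2 L^2 (H + 1)^2 of [modulus_window_average] at most e / 3 * N * (H
   + 1). *)
have Nbig : 6 * (L%:num * L%:num) * H.+1%:R / e <= N%:R by near: N; exact: nbhs_infty_ger.
rewrite sub0r normrN ger0_norm ?modulus_ge0// modulusM.
have -> : modulus ((N%:R : R[i])^-1) = N%:R^-1.
  by rewrite -(rmorph_nat (real_complex R)) -fmorphV modulus_real_complex
    ger0_norm ?invr_ge0.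
rewrite ler_pdivrMl//.
have sumG : \sum_(n < N) G (iter n S u) <= N%:R * (d + d).
  by rewrite -ler_pdivrMl//; exact: hN1.
have := hN0 N (fun n => (ix n).2) NN0.
have := modulus_window_average N H aL.
set A := modulus _; set W := \sum_(n < N) modulus _;
  set B := \sum_(n < N) block_sum _ _ _ _ _ _.
move=> hA hB.
have hW : W <= L%:num * H.+1%:R * (N%:R * (d + d) + N%:R * d) + B.
  apply: (@le_trans _ _ (\sum_(n < N) (L%:num * H.+1%:R * (G (iter n S u) + d) +
    block_sum T v fc n H.+1 (ix n).2))); first by apply: ler_sum.
  rewrite big_split /= lerD// -mulr_sumr ler_wpM2l ?mulr_ge0// big_split /= lerD//.
  by rewrite sumr_const card_ord mulr_natl.
rewrite -(ler_pM2l (x := H.+1%:R))//.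
apply: (le_trans hA).
rewrite ler_pdivrMr// in Nbig.
have dL : d * L%:num * 9 = e by rewrite /d; field; rewrite gt_eqF.
have H0 : 0 < H.+1%:R :> R by [].
move: hW hB Nbig dL H0 N_gt0; set h : R := H.+1%:R; set nn : R := N%:R; set l := L%:num.
move=> hW hB Nbig dL H0 N_gt0.
have Nb : 6 * (l * l) * h * h <= nn * e * h by rewrite ler_pM2r.
have hd : l * h * (nn * (d + d) + nn * d) = (d * l * 9) * nn * h / 3 by field.
rewrite hd dL in hW.
lra.
Unshelve. all: by end_near. Qed.
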